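(* Let $\mathcal{M}_0^{\mathsf{UI}}$ be the collection of uniformly integrable $\mathbb{G}$-martingales $(M_i)_{i\in\mathbb{N}_0}$ with $M_0=0$. Assume that $\mathbb{E}[\sup_{i\in\mathbb{N}_0}Z_{\tau_i}^{\alpha}]\le B^{\alpha}$ for some $B>0$ and $\alpha>1$, and that $$\mathbb{E}\left[N_T\sup_{i\in\mathbb{N}_0}U_i\right]<\infty.$$ Then the following hold. (i) (Weak duality) $$\sup_{\mathfrak{n}\in\mathcal{N}}\mathbb{E}[U_{\mathfrak{n}}]=\inf_{M\in\mathcal{M}_0^{\mathsf{UI}}}\mathbb{E}\left[\sup_{i\ge0}(U_i-M_i)\right].$$ (ii) (Strong duality) Let $$M_i^{\circ}:=\sum_{j=1}^{i}\left(Y_j-\mathbb{E}_{\mathcal{G}_{j-1}}[Y_j]\right),\quad i\ge1,\qquad M_0^{\circ}=0.$$ Then $M^{\circ}\in\mathcal{M}_0^{\mathsf{UI}}$ and $$Y_0=\sup_{i\ge0}(U_i-M_i^{\circ})\quad\text{a.s.}$$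
   Context: $\mathbb{N}=\{1,2,\dots\}$, $\mathbb{N}_0=\mathbb{N}\cup\{0\}$; $\mathbb{E}_{\mathcal{H}}$ denotes conditional expectation given $\mathcal{H}$. $(\Omega,\mathcal{F},\mathbb{F},\mathbb{P})$ is a filtered probability space with $\mathbb{F}=(\mathcal{F}_t)_{0\le t\le\infty}$ satisfying the usual conditions. $(\tau_i)_{i\in\mathbb{N}_0}$ is a sequence of $\mathbb{F}$-stopping times with, a.s., $\tau_0=0$, $\tau_i<\tau_{i+1}<\infty$ for all $i\in\mathbb{N}_0$, and $\lim_{i\to\infty}\tau_i=\infty$. $T\in(0,\infty)$ is a fixed horizon. $Z=(Z_t)_{0\le t<\infty}$ is a non-negative $\mathbb{F}$-adapted process, càdlàg on $[0,T]$, such that almost surely $Z_t=0$ for all $t>T$. $N_T:=\min\{m\in\mathbb{N}:\tau_m>T\}$. $U_i:=Z_{\tau_i}$, $\mathcal{G}_i:=\mathcal{F}_{\tau_i}$ (the stopping-time $\sigma$-algebra), $\mathbb{G}:=(\mathcal{G}_i)_{i\in\mathbb{N}_0}$, and $\mathcal{N}$ is the set of all maps $\mathfrak{n}:\Omega\to\mathbb{N}_0$ with $\{\mathfrak{n}=i\}\in\mathcal{G}_i$ for all $i\in\mathbb{N}_0$. The Snell envelope is $$Y_i\equiv Y_i^{(\infty)}:=\operatorname*{ess\,sup}_{\mathfrak{n}\in\mathcal{N},\ \mathfrak{n}\ge i}\mathbb{E}_{\mathcal{G}_i}[U_{\mathfrak{n}}],\quad i\in\mathbb{N}_0.$$ 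*)

(* Defs.v *)
From HB Require Import structures.
From mathcomp Require Import all_boot all_order all_algebra.
From mathcomp Require Import all_classical all_reals all_analysis.
Set Implicit Arguments.
Unset Strict Implicit.
Unset Printing Implicit Defensive.
Import Order.TTheory GRing.Theory Num.Theory.
Import numFieldNormedType.Exports.
Local Open Scope classical_set_scope.
Local Open Scope ring_scope.
Local Open Scope ereal_scope.

Section conditional_expectation.
Context (d : measure_display) (Omega : measurableType d) (R : realType).
Variable P : probability Omega R.
Implicit Types (G : set (set Omega)) (X W : Omega -> R).

(* When G is a sigma-algebra, the measurable sets of g_sigma_algebraType G
   are exactly the elements of G. *)
Definition measurable_wrt G X : Prop :=
  measurable_fun [set: g_sigma_algebraType G] (X : g_sigma_algebraType G -> R).

Definition integrable_rv X : Prop := P.-integrable setT (EFin \o X).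

Definition is_condexp G X W : Prop :=
  [/\ measurable_wrt G W, integrable_rv W &
      forall A, G A -> \int[P]_(w in A) (W w)%:E = \int[P]_(w in A) (X w)%:E].

(* A version of the conditional expectation of X given G, the zero function
   if there is none (there is one as soon as X is integrable and G is a
   sub-sigma-algebra). *)
Definition condexp G X : Omega -> R := xget (fun=> 0%R) (is_condexp G X).

(* Almost sure least upper bound of a (possibly uncountable) family of real
   random variables; not to be confused with the essential supremum of a
   single function.  Y being real-valued, this says that the essential supremum
   of Phi in [-oo, +oo] is almost surely finite and equal to Y. *)
Definition is_ess_sup_family (Phi : set (Omega -> R)) (Y : Omega -> R) : Prop :=
  [/\ measurable_fun setT Y,
      forall X, Phi X -> {ae P, forall w, (X w <= Y w)%R} &
      forall Y' : Omega -> R, measurable_fun setT Y' ->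
        (forall X, Phi X -> {ae P, forall w, (X w <= Y' w)%R}) ->
        {ae P, forall w, (Y w <= Y' w)%R}].

Definition ess_sup_family (Phi : set (Omega -> R)) : Omega -> R :=
  xget (fun=> 0%R) (is_ess_sup_family Phi).

End conditional_expectation.

Section continuous_time.
Context (d : measure_display) (Omega : measurableType d) (R : realType).
Variable P : probability Omega R.

(* Time ranges over [0, +oo], so that F +oo is part of the data; the values of
   F at negative times are irrelevant. *)
Definition is_filtration (F : \bar R -> set (set Omega)) : Prop :=
  [/\ forall t, 0 <= t -> sigma_algebra setT (F t),
      forall t, 0 <= t -> F t `<=` measurable &
      forall s t, 0 <= s -> s <= t -> F s `<=` F t].

(* The second condition also forces the completeness of P, because
   F 0 `<=` measurable. *)
Definition usual_conditions (F : \bar R -> set (set Omega)) : Prop :=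
  (forall t, 0 <= t -> t < +oo ->
     F t = [set A | forall s, t < s -> F s A]) /\
  (forall A : set Omega, P.-negligible A -> F 0 A).

Definition stopping_time (F : \bar R -> set (set Omega))
    (tau : Omega -> \bar R) : Prop :=
  (forall w, 0 <= tau w) /\ forall t, 0 <= t -> F t [set w | tau w <= t].

(* The instance t = +oo says that A belongs to F +oo. *)
Definition stopped_sigma_algebra (F : \bar R -> set (set Omega))
    (tau : Omega -> \bar R) : set (set Omega) :=
  [set A | forall t, 0 <= t -> F t (A `&` [set w | tau w <= t])].

Definition adapted (F : \bar R -> set (set Omega)) (Z : R -> Omega -> R) : Prop :=
  forall t : R, (0 <= t)%R -> measurable_wrt (F t%:E) (Z t).

(* No right-continuity is required at the right endpoint T. *)
Definition cadlag_on (T : R) (f : R -> R) : Prop :=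
  (forall t : R, (0 <= t < T)%R -> f s @[s --> t^'+] --> f t) /\
  (forall t : R, (0 < t <= T)%R -> cvg (f s @[s --> t^'-])).

(* Z is indexed by finite times; the value 0 on {tau = +oo} is a convention,
   that event being null for the times under consideration. *)
Definition sample_at (Z : R -> Omega -> R) (tau : Omega -> \bar R) : Omega -> R :=
  fun w => if tau w is t%:E then Z t w else 0%R.

(* min {m >= 1 | tau_m > T}, with value +oo when there is no such m. *)
Definition first_index_after (tau : nat -> Omega -> \bar R) (T : R) (w : Omega)
    : \bar R :=
  ereal_inf [set (m%:R)%:E | m in [set m : nat | (0 < m)%N /\ T%:E < tau m w]].

End continuous_time.

Section discrete_time.
Context (d : measure_display) (Omega : measurableType d) (R : realType).
Variables (P : probability Omega R) (G : nat -> set (set Omega)).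

Definition stopping_rule : set (Omega -> nat) :=
  [set n | forall i, G i [set w | n w = i]].

Definition at_rule (U : nat -> Omega -> R) (n : Omega -> nat) : Omega -> R :=
  fun w => U (n w) w.

Definition martingale (M : nat -> Omega -> R) : Prop :=
  [/\ forall i, measurable_wrt (G i) (M i),
      forall i, integrable_rv P (M i) &
      forall i j, (i <= j)%N -> {ae P, forall w, condexp P (G i) (M j) w = M i w}].

Definition uniformly_integrable (M : nat -> Omega -> R) : Prop :=
  forall e : R, (0 < e)%R -> exists K : R, forall i,
    \int[P]_(w in [set w | (K <= `|M i w|)%R]) (`|M i w|%R)%:E <= e%:E.

Definition UI_martingale0 : set (nat -> Omega -> R) :=
  [set M | [/\ martingale M, uniformly_integrable M &
               {ae P, forall w, M 0%N w = 0%R}]].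

Definition snell_envelope (U : nat -> Omega -> R) (i : nat) : Omega -> R :=
  ess_sup_family P
    [set condexp P (G i) (at_rule U n)
       | n in [set n | stopping_rule n /\ forall w, (i <= n w)%N]].

(* Martingale part of the Doob decomposition of Y, null at time 0. *)
Definition doob_martingale (Y : nat -> Omega -> R) (i : nat) : Omega -> R :=
  fun w => (\sum_(1 <= j < i.+1) (Y j w - condexp P (G j.-1) (Y j) w))%R.

End discrete_time.

(* Main.v *)
(** The sampled problem is a discrete optimal stopping problem in which the
    reward vanishes from a random but finite index on.  The value [Y] is the
    limit of value iteration, hence [Y i = max (U i) (E_i [Y i.+1])], and the
    first [j >= i] with [Y j = U j] exists almost surely and attains the
    essential supremum defining the Snell envelope.  The Doob decomposition
    [Y = Y_0 + M - A] gives [U_i - M_i <= Y_0 - A_i <= Y_0], with equality at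
    the first [j] with [Y j = U j], up to which [A] vanishes.  Moreover
    [|M_i| <= Y_i + Y_0 + A_oo], where [Y_i] is dominated by [E_i (sup U)] and
    [E A_oo <= E Y_0], so that [M] is uniformly integrable.  Weak duality is
    optional stopping for the truncated rules [min n j].  Integrability of [sup U]
    follows from [1 <= first_index_after tau T w]. *)
Require Import Defs.
From HB Require Import structures.
From mathcomp Require Import all_boot all_order all_algebra.
From mathcomp Require Import all_classical all_reals all_analysis.
From mathcomp Require Import measurable_realfun lra.
Import Order.TTheory GRing.Theory Num.Theory.
Import numFieldNormedType.Exports.
Local Open Scope classical_set_scope.
Local Open Scope ring_scope.
Local Open Scope ereal_scope.
Set Implicit Arguments.
Unset Strict Implicit.
Unset Printing Implicit Defensive.

(** * Conditional expectations *)

(** Conditional expectations and essential suprema are chosen versions, known only up to null sets,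
    and the sampling times are ordered only almost surely. Completeness of the sigma-algebras
    absorbs all of this, and conditional statements at index [i] are tested through integrals over
    events of [G i]. The equation [Y i = max (U i) (E_i [Y i.+1])] alone does not determine [Y]: a
    constant above every [U i] solves it too. The solution is singled out by the bound of [Y i] by
    the conditional expectation of the supremum of the [U j] with [i <= j], a bound that value
    iteration preserves. On the event that the time of index [i] exceeds [T] this supremum vanishes,
    which forces [Y i = 0 = U i]; since the times tend to infinity, [Y] meets [U] after every index.
    The obstacle in continuous time is the measurability of the sampled reward. Paths are
    right-continuous only before [T], so the cases of a time before, at and after [T] call for three
    different arguments. *)

Section sub_sigma_algebra.
Context {d : measure_display} {Omega : measurableType d} {R : realType}.
Variable P : probability Omega R.
Implicit Types (G H : set (set Omega)) (A : set Omega) (X Y W : Omega -> R).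

(** All negligible sets are included, so that altering an event or a function on a null set keeps it
    measurable. The usual conditions provide this for each [F t] and for each stopped
    sigma-algebra. *)
Definition complete_sub_sigma G : Prop :=
  [/\ sigma_algebra setT G, G `<=` measurable &
      forall A, P.-negligible A -> G A].

Lemma measurable_wrtP G X : sigma_algebra setT G ->
  measurable_wrt G X <-> forall B, measurable B -> G (X @^-1` B).
Proof.
move=> sG; rewrite /measurable_wrt; split=> [mX B mB|GX _ B mB].
  have := mX measurableT B mB.
  by rewrite setTI measurable_g_measurableTypeE.
by rewrite setTI measurable_g_measurableTypeE //; exact: GX.
Qed.

Lemma measurable_wrtS G H X : sigma_algebra setT G -> sigma_algebra setT H ->
  G `<=` H -> measurable_wrt G X -> measurable_wrt H X.
Proof.
move=> sG sH GH /(@measurable_wrtP _ _ sG) GX.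
by apply/(@measurable_wrtP _ _ sH) => B mB; apply/GH/GX.
Qed.

Lemma measurable_wrt_fun G X : sigma_algebra setT G -> G `<=` measurable ->
  measurable_wrt G X -> measurable_fun setT X.
Proof.
move=> sG mG /(@measurable_wrtP _ _ sG) GX _ B mB.
by rewrite setTI; apply/mG/GX.
Qed.

Lemma measurable_wrtB G X Y :
  measurable_wrt G X -> measurable_wrt G Y -> measurable_wrt G (X \- Y)%R.
Proof. by move=> mX mY; exact: measurable_funB. Qed.

Lemma measurable_wrtD G X Y :
  measurable_wrt G X -> measurable_wrt G Y -> measurable_wrt G (X \+ Y)%R.
Proof. by move=> mX mY; exact: measurable_funD. Qed.

Lemma measurable_wrt_max G X Y :
  measurable_wrt G X -> measurable_wrt G Y -> measurable_wrt G (X \max Y)%R.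
Proof. by move=> mX mY; exact: measurable_maxr. Qed.

Lemma sigma_ltr G X Y : sigma_algebra setT G ->
  measurable_wrt G X -> measurable_wrt G Y -> G [set w | (X w < Y w)%R].
Proof.
move=> sG mX mY.
have : measurable_fun [set: g_sigma_algebraType G]
    (fun w => (X w < Y w)%R : bool) by exact: measurable_fun_ltr.
have mt : measurable [set true] by [].
move=> /(_ measurableT [set true] mt).
by rewrite setTI measurable_g_measurableTypeE.
Qed.

Lemma sigma_setC G A : sigma_algebra setT G -> G A -> G (~` A).
Proof. by case=> _ GC _ GA; rewrite -setTD; exact: GC. Qed.

Lemma sigma_setI G A B : sigma_algebra setT G -> G A -> G B -> G (A `&` B).
Proof.
move=> sG; have := @measurableI _ (g_sigma_algebraType G) A B.
by rewrite measurable_g_measurableTypeE.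
Qed.

Lemma sigma_setU G A B : sigma_algebra setT G -> G A -> G B -> G (A `|` B).
Proof.
move=> sG; have := @measurableU _ (g_sigma_algebraType G) A B.
by rewrite measurable_g_measurableTypeE.
Qed.

(** Every subset of the exceptional set [N] is negligible and thus belongs to [G]; [B] is then glued
    from [A] off [N] and from its own part inside [N]. *)
Lemma complete_sub_sigma_ae_eqset G A B : complete_sub_sigma G ->
  {ae P, forall w, A w <-> B w} -> G A -> G B.
Proof.
move=> [sG mG nG] AB GA.
pose N := ~` [set w | A w <-> B w].
have GS C : C `<=` N -> G C by move=> CN; apply: nG; exact: negligibleS AB.
have -> : B = (A `&` ~` N) `|` (B `&` N).
  apply/seteqP; split=> w /=; rewrite /N /=.
    move=> Bw; have [abw|nab] := pselect (A w <-> B w); [left|by right].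
    by split; [exact/abw|move/(_ abw)].
  by move=> [[Aw /contrapT ABw]|[]//]; exact/ABw.
apply: (sigma_setU sG); last by apply: GS => w [].
by apply: (sigma_setI sG) => //; apply: (sigma_setC sG); exact: GS.
Qed.

Lemma measurable_wrt_ae G X Y : complete_sub_sigma G ->
  {ae P, forall w, X w = Y w} -> measurable_wrt G X -> measurable_wrt G Y.
Proof.
move=> cG XY; have [sG _ _] := cG.
move=> /(@measurable_wrtP _ _ sG) GX; apply/(@measurable_wrtP _ _ sG) => B mB.
apply: (complete_sub_sigma_ae_eqset cG _ (GX B mB)).
by apply: filterS XY => w /= ->.
Qed.

Lemma integrable_rvS A X : measurable A -> integrable_rv P X ->
  P.-integrable A (EFin \o X).
Proof. by move=> mA iX; exact: integrableS iX. Qed.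

Lemma integrable_rv_measurable X : integrable_rv P X -> measurable_fun setT X.
Proof. by move/(measurable_int P)/measurable_EFinP. Qed.

Lemma ae_le_integral A X Y : measurable A ->
  integrable_rv P X -> integrable_rv P Y ->
  {ae P, forall w, A w -> (X w <= Y w)%R} ->
  \int[P]_(w in A) (X w)%:E <= \int[P]_(w in A) (Y w)%:E.
Proof.
move=> mA iX iY XY.
have iXA := integrable_rvS mA iX; have iYA := integrable_rvS mA iY.
(* The minimum agrees with [X] almost everywhere on [A] and lies below [Y] everywhere, so the
   pointwise comparison of integrals applies to it. *)
have -> : \int[P]_(w in A) (X w)%:E = \int[P]_(w in A) (Num.min (X w) (Y w))%:E.
  apply: ae_eq_integral => //.
  - exact: (measurable_int P).
  - apply/measurable_EFinP/measurable_minr; apply/measurable_EFinP;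
      exact: (measurable_int P).
  - by apply: filterS XY => w /= XY Aw; rewrite min_l ?XY.
apply: le_integral => //; last by move=> w _; rewrite lee_fin ge_min lexx orbT.
apply: (le_integrable mA) (integrableD mA (integrable_abse iXA)
  (integrable_abse iYA)) => //.
  apply/measurable_EFinP/measurable_minr; apply/measurable_EFinP;
      exact: (measurable_int P).
move=> w _; rewrite /comp [leRHS]gee0_abs ?adde_ge0//.
by rewrite /Num.min; case: ifP => _; rewrite ?leeDl ?leeDr.
Qed.

Lemma ae_integral_ge0 A X : measurable A -> integrable_rv P X ->
  {ae P, forall w, (0 <= X w)%R} -> 0 <= \int[P]_(w in A) (X w)%:E.
Proof.
move=> mA iX X0; rewrite -(integral0 P A).
apply: (@ae_le_integral A (cst 0%R)) => //.
  by apply: eq_integrable (integrable0 P setT).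
by apply: filterS X0 => w.
Qed.

Lemma ae_eq_integral_rv A X Y : measurable A ->
  measurable_fun setT X -> measurable_fun setT Y ->
  {ae P, forall w, X w = Y w} ->
  \int[P]_(w in A) (X w)%:E = \int[P]_(w in A) (Y w)%:E.
Proof.
move=> mA mX mY XY; apply: ae_eq_integral => //.
- by apply: (measurable_funS measurableT) => //; exact/measurable_EFinP.
- by apply: (measurable_funS measurableT) => //; exact/measurable_EFinP.
- by apply: filterS XY => w /= -> _.
Qed.

Lemma ae_integrable_rv X Y : measurable_fun setT Y ->
  {ae P, forall w, X w = Y w} -> integrable_rv P X -> integrable_rv P Y.
Proof.
move=> mY XY iX; have mX := integrable_rv_measurable iX.
apply/integrableP; split; first exact/measurable_EFinP.
move/integrableP : iX => [_]; apply: le_lt_trans.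
rewrite le_eqVlt; apply/orP; left; apply/eqP.
apply: ae_eq_integral => //; try by
  apply: measurableT_comp => //; exact/measurable_EFinP.
by apply: filterS XY => w /= ->.
Qed.

(** The test event is [Y < X], which lies in [G]: there [X - Y] is positive with integral at most 0,
    so the event is null. *)
Lemma ae_le_of_integral G X Y : sigma_algebra setT G -> G `<=` measurable ->
  measurable_wrt G X -> measurable_wrt G Y ->
  integrable_rv P X -> integrable_rv P Y ->
  (forall A, G A -> \int[P]_(w in A) (X w)%:E <= \int[P]_(w in A) (Y w)%:E) ->
  {ae P, forall w, (X w <= Y w)%R}.
Proof.
move=> sG mG mX mY iX iY XY.
pose A := [set w | (Y w < X w)%R].
have GA : G A by exact: sigma_ltr.
have mA : measurable A := mG _ GA.
have iXA := integrable_rvS mA iX; have iYA := integrable_rvS mA iY.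
pose D : Omega -> \bar R := fun w => (X w - Y w)%:E.
have mD : measurable_fun A D.
  apply/measurable_EFinP/measurable_funTS/measurable_funB;
    exact: integrable_rv_measurable.
have : \int[P]_(w in A) `|D w| = 0.
  apply/eqP; rewrite eq_le integral_ge0 // andbT.
  have -> : \int[P]_(w in A) `|D w| = \int[P]_(w in A) ((X w)%:E - (Y w)%:E).
    apply: eq_integral => w /set_mem Aw.
    by rewrite gee0_abs // lee_fin subr_ge0 ltW.
  rewrite integralB //= leeBlDr; last exact: integrable_fin_num.
  by rewrite add0e; exact: XY.
move/(ae_eq_integral_abs P mA mD) => H.
apply: filterS H => w /= H; rewrite leNgt; apply/negP => Aw.
by have /eqP := H Aw; rewrite /D eqe subr_eq0 gt_eqF.
Qed.

Lemma measurable_ereal_sup (X : nat -> Omega -> R) :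
  (forall i, measurable_fun setT (X i)) ->
  measurable_fun setT
    (fun w => ereal_sup [set (X i w)%:E | i in [set: nat]]).
Proof.
move=> mX.
rewrite (_ : (fun w => _) = fun w => esups (fun i => (X i w)%:E) 0%N).
  apply: (@measurable_fun_esups _ _ _ setT (fun i w => (X i w)%:E)) => i.
  exact/measurable_EFinP.
apply/funext => w; congr ereal_sup.
by apply/seteqP; split=> x [k] _ <-; exists k.
Qed.

(** Radon-Nikodym on the coarser space. The map [phi] is the identity onto the same set equipped
    with [G]; pushing forward along it restricts to [G] both [P] and the charge with density [X].
    The derivative is therefore measurable for [G] by construction. *)
Lemma is_condexp_exists G X : sigma_algebra setT G -> G `<=` measurable ->
  integrable_rv P X -> exists W, is_condexp P G X W.
Proof.
move=> sG mG iX.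
pose T' := g_sigma_algebraType G.
pose phi : Omega -> T' := id.
have mphi : measurable_fun setT phi.
  by move=> _ B; rewrite measurable_g_measurableTypeE // setTI => /mG.
pose phi' : {RV P >-> T'} := HB.pack phi
   (isMeasurableFun.Build _ _ _ _ _ mphi).
pose mu : probability T' R := distribution P phi'.
have numu : pushforward (induced_charge iX) phi `<< mu.
  apply: dominates_pushforward => //.
  apply/null_content_dominatesP => A mA PA.
  apply: null_set_integral => //.
  exact: (measurable_int P (integrable_rvS mA iX)).
pose W0 := Radon_Nikodym (pushforward (induced_charge iX) phi) mu.
pose W : T' -> \bar R := W0 mphi.
have Wfin (w : T') : W w \is a fin_num by exact: Radon_Nikodym_fin_num.
have iW : mu.-integrable [set: T'] W 
  by exact: Radon_Nikodym_integrable.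
have mW : @measurable_fun _ _ T' _ setT W := measurable_int mu iW.
have iWP : P.-integrable setT W.
  apply/integrableP; split.
    move=> _ B mB; rewrite setTI; apply: mG.
    rewrite -(measurable_g_measurableTypeE sG).
    by have := mW measurableT B mB; rewrite setTI.
  move/integrableP : iW => [_]; rewrite ge0_integral_pushforward //.
  exact: measurableT_comp.
have fW : EFin \o (fine \o W) = W by apply/funext => w /=; rewrite fineK.
exists (fine \o W); split.
- exact: (measurableT_comp (@fine_measurable R setT measurableT) mW).
- by rewrite /integrable_rv fW.
- move=> A GA.
  have mA : G.-sigma.-measurable A by rewrite measurable_g_measurableTypeE.
  have iWA : P.-integrable (phi @^-1` A) (W \o phi).
    by apply: (integrableS measurableT _ _ iWP) => //; exact: mG.
  have E := integral_pushforward mphi mW iWA mA.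
  have -> : \int[P]_(w in A) ((fine \o W) w)%:E = \int[P]_(w in A) W w.
    by apply: eq_integral => w _ /=; rewrite fineK.
  by rewrite -[LHS]E -(Radon_Nikodym_integral numu mA).
Qed.
Lemma ae_eq_of_integral G X Y : sigma_algebra setT G -> G `<=` measurable ->
  measurable_wrt G X -> measurable_wrt G Y ->
  integrable_rv P X -> integrable_rv P Y ->
  (forall A, G A -> \int[P]_(w in A) (X w)%:E = \int[P]_(w in A) (Y w)%:E) ->
  {ae P, forall w, X w = Y w}.
Proof.
move=> sG mG mX mY iX iY XY.
have h1 : {ae P, forall w, (X w <= Y w)%R}.
  by apply: (ae_le_of_integral sG mG) => // A GA; rewrite XY.
have h2 : {ae P, forall w, (Y w <= X w)%R}.
  by apply: (ae_le_of_integral sG mG) => // A GA; rewrite XY.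
by apply: filterS2 h1 h2 => w h1 h2; apply/eqP; rewrite eq_le h1 h2.
Qed.

Lemma condexpP G X : sigma_algebra setT G -> G `<=` measurable ->
  integrable_rv P X -> is_condexp P G X (condexp P G X).
Proof. by move=> sG mG iX; apply: xgetPex; exact: is_condexp_exists. Qed.

Lemma condexp_ae G X W : sigma_algebra setT G -> G `<=` measurable ->
  is_condexp P G X W -> {ae P, forall w, condexp P G X w = W w}.
Proof.
move=> sG mG XW; have [mW iW XWE] := XW.
have [mC iC CE] : is_condexp P G X (condexp P G X) by apply: xgetPex; exists W.
by apply: (ae_eq_of_integral sG mG) => // A GA; rewrite CE // XWE.
Qed.

(** The equality holds everywhere and not just almost surely: both variables have exactly the same
    versions, so [xget] makes the same choice. *)
Lemma condexp_congr G X Y : G `<=` measurable ->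
  measurable_fun setT X -> measurable_fun setT Y ->
  {ae P, forall w, X w = Y w} -> condexp P G X = condexp P G Y.
Proof.
move=> mG mX mY XY; congr xget; apply/funext => W; apply/propext.
by split=> -[mW iW WE]; split=> // A GA; rewrite WE //;
  [|apply/esym]; apply: ae_eq_integral_rv => //; exact: mG.
Qed.

Lemma integral_split A B X : measurable A -> measurable B ->
  integrable_rv P X ->
  \int[P]_(w in A) (X w)%:E =
  \int[P]_(w in A `&` B) (X w)%:E + \int[P]_(w in A `\` B) (X w)%:E.
Proof.
move=> mA mB iX; rewrite -[in LHS](setUIDK A B) integral_setU //.
- exact: measurableI.
- exact: measurableD.
- apply/measurable_funTS/measurable_EFinP; exact: integrable_rv_measurable.
- by apply/disj_setPS => w [[_ Bw] [_]].
Qed.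

Lemma integral_rv_fin A X : measurable A -> integrable_rv P X ->
  \int[P]_(w in A) (X w)%:E \is a fin_num.
Proof.
by move=> mA iX; apply: integrable_fin_num => //; exact: integrable_rvS.
Qed.

Lemma integrable_rvB X Y : integrable_rv P X -> integrable_rv P Y ->
  integrable_rv P (X \- Y)%R.
Proof. by move=> iX iY; exact: (integrableB measurableT iX iY). Qed.

Lemma integrable_rv_norm X : integrable_rv P X ->
  integrable_rv P (fun w => `|X w|)%R.
Proof. by move=> iX; exact: (integrable_norm (iX : P.-integrable _ _)). Qed.

Lemma integrable_rvD X Y : integrable_rv P X -> integrable_rv P Y ->
  integrable_rv P (X \+ Y)%R.
Proof. by move=> iX iY; exact: (integrableD measurableT iX iY). Qed.

Lemma integral_rvB A X Y : measurable A ->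
  integrable_rv P X -> integrable_rv P Y ->
  \int[P]_(w in A) (X w - Y w)%:E =
  \int[P]_(w in A) (X w)%:E - \int[P]_(w in A) (Y w)%:E.
Proof. by move=> mA iX iY; rewrite -integralB //; exact: integrable_rvS. Qed.

Lemma integral_rvD A X Y : measurable A ->
  integrable_rv P X -> integrable_rv P Y ->
  \int[P]_(w in A) (X w + Y w)%:E =
  \int[P]_(w in A) (X w)%:E + \int[P]_(w in A) (Y w)%:E.
Proof. by move=> mA iX iY; rewrite -integralD //; exact: integrable_rvS. Qed.

Lemma ae_dominated_integrable X Y : measurable_fun setT X ->
  {ae P, forall w, (`|X w| <= Y w)%R} -> integrable_rv P Y -> integrable_rv P X.
Proof.
move=> mX XY iY; have mY := integrable_rv_measurable iY.
apply/integrableP; split; first exact/measurable_EFinP.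
move/integrableP : iY => [_]; apply: le_lt_trans.
apply: ae_ge0_le_integral => //; try by
  apply: measurableT_comp => //; exact/measurable_EFinP.
by apply: filterS XY => w /= XY _; rewrite lee_fin (le_trans XY) ?ler_norm.
Qed.

End sub_sigma_algebra.

(** * Value iteration *)

Section snell.
Context {d : measure_display} {Omega : measurableType d} {R : realType}.
Variables (P : probability Omega R) (G : nat -> set (set Omega)).
Variable U : nat -> Omega -> R.
Hypothesis cG : forall i, complete_sub_sigma P (G i).
Hypothesis subG : forall i j, (i <= j)%N -> G i `<=` G j.
Hypothesis mU : forall i, measurable_wrt (G i) (U i).
Hypothesis U_ge0 : forall i w, (0 <= U i w)%R.
Hypothesis int_supU :
  \int[P]_w ereal_sup [set (U i w)%:E | i in [set: nat]] < +oo.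

Let sG i : sigma_algebra setT (G i). Proof. by have [] := cG i. Qed.
Let mG i : G i `<=` measurable. Proof. by have [] := cG i. Qed.

Lemma measurable_process i : measurable_fun setT (U i).
Proof. exact: (measurable_wrt_fun (sG i)). Qed.

(** Where the supremum is infinite, a null event, [fine] returns 0. *)
Definition future_sup i w : R := fine (esups (fun j => (U j w)%:E) i).

Let esupsU_ge0 i w : 0 <= esups (fun j => (U j w)%:E) i.
Proof.
apply: (@le_trans _ _ (U i w)%:E); first by rewrite lee_fin.
by apply: ereal_sup_ubound; exists i => //=.
Qed.

Let measurable_esupsU i :
  measurable_fun setT (fun w => esups (fun j => (U j w)%:E) i).
Proof.
apply: (@measurable_fun_esups _ _ _ setT (fun j w => (U j w)%:E)) => j.
by apply/measurable_EFinP; exact: measurable_process.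
Qed.

Let esupsU0 w : esups (fun j => (U j w)%:E) 0%N =
  ereal_sup [set (U i w)%:E | i in [set: nat]].
Proof. by congr ereal_sup; apply/seteqP; split=> x [k] _ <-; exists k. Qed.

Let esupsU_le i j w : (i <= j)%N ->
  esups (fun j => (U j w)%:E) j <= esups (fun j => (U j w)%:E) i.
Proof.
move=> ij; apply: ereal_sup_le => _ [k /= jk <-].
by exists k => //=; exact: leq_trans jk.
Qed.

Let integrable_esupsU i :
  P.-integrable setT (fun w => esups (fun j => (U j w)%:E) i).
Proof.
apply/integrableP; split; first exact: measurable_esupsU.
apply: le_lt_trans int_supU; apply: ge0_le_integral => //.
- by apply: measurableT_comp => //; exact: measurable_esupsU.
- have <- : (fun w => esups (fun j => (U j w)%:E) 0%N) =
      (fun w => ereal_sup [set (U i w)%:E | i in [set: nat]]).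
    by apply/funext => w; rewrite esupsU0.
  exact: measurable_esupsU.
- move=> w _; rewrite gee0_abs // (le_trans (esupsU_le w (leq0n i))) //.
  by rewrite esupsU0.
Qed.

Let ae_esupsU_fin :
  {ae P, forall w i, esups (fun j => (U j w)%:E) i \is a fin_num}.
Proof.
have := integrable_ae measurableT (integrable_esupsU 0%N).
apply: filterS => w /(_ I) fin0 i.
rewrite ge0_fin_numE // (le_lt_trans (esupsU_le w (leq0n i))) //.
by rewrite -ge0_fin_numE.
Qed.

Lemma integrable_future_sup i : integrable_rv P (future_sup i).
Proof.
have mS : measurable_fun setT (future_sup i).
  by apply: (measurableT_comp (@fine_measurable R setT measurableT)).
apply/integrableP; split; first exact/measurable_EFinP.
have /integrableP[_] := integrable_esupsU i; apply: le_lt_trans.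
apply: ge0_le_integral => //.
- by apply: measurableT_comp => //; exact/measurable_EFinP.
- exact: measurableT_comp.
- move=> w _; rewrite /= /future_sup.
  by case: (esups _ _) => [r| |] //=; rewrite normr0 leey.
Qed.

Lemma future_sup_ge0 i w : (0 <= future_sup i w)%R.
Proof. exact: fine_ge0. Qed.

Lemma ae_le_future_sup :
  {ae P, forall w i j, (i <= j)%N -> (U j w <= future_sup i w)%R}.
Proof.
apply: filterS ae_esupsU_fin => w fin i j ij.
rewrite -lee_fin /future_sup fineK //.
by apply: ereal_sup_ubound; exists j.
Qed.

Lemma ae_future_sup_le i j : (i <= j)%N ->
  {ae P, forall w, (future_sup j w <= future_sup i w)%R}.
Proof.
by move=> ij; apply: filterS ae_esupsU_fin => w fin; rewrite fine_le ?esupsU_le.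
Qed.

Lemma integrable_U i : integrable_rv P (U i).
Proof.
apply: ae_dominated_integrable (integrable_future_sup i).
  exact: measurable_process.
by apply: filterS ae_le_future_sup => w H; rewrite ger0_norm ?H.
Qed.

Lemma ae_U_le_condexp i :
  {ae P, forall w, (U i w <= condexp P (G i) (future_sup i) w)%R}.
Proof.
have [mC iC CE] := condexpP (sG i) (@mG i) (integrable_future_sup i).
apply: (ae_le_of_integral (sG i) (@mG i)) => //; first exact: integrable_U.
move=> A GA; rewrite CE //; apply: ae_le_integral => //.
- exact: (mG GA).
- exact: integrable_U.
- exact: integrable_future_sup.
- by apply: filterS ae_le_future_sup => w H _; exact: H.
Qed.

(* The maximum with the previous iterate makes the iteration monotone in [k]
   everywhere, and not only almost surely. *)
Fixpoint value_iter k i : Omega -> R :=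
  if k is k'.+1 then
    (value_iter k' i \max (U i \max condexp P (G i) (value_iter k' i.+1)))%R
  else U i.

Lemma value_iter_ge0 k i w : (0 <= value_iter k i w)%R.
Proof. by elim: k i => [|k IH] i //=; rewrite le_max IH. Qed.

Lemma value_iterS_le k i w : (value_iter k i w <= value_iter k.+1 i w)%R.
Proof. by rewrite /= le_max lexx. Qed.

Lemma value_iter_nd w i : nondecreasing_seq (fun k => value_iter k i w).
Proof. by apply/nondecreasing_seqP => k; exact: value_iterS_le. Qed.

(** One induction carries all three properties, since the conditional expectation in the next
    iterate is meaningful only once the present iterate is integrable. The bound is uniform in [k]:
    it reproduces itself by the tower property and because [future_sup] decreases in its index. *)
Lemma value_iter_bound k : forall i,
  [/\ measurable_wrt (G i) (value_iter k i), integrable_rv P (value_iter k i) &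
   {ae P, forall w, (value_iter k i w <= condexp P (G i) (future_sup i) w)%R}].
Proof.
elim: k => [|k IH] i.
  by split; [exact: mU|exact: integrable_U|exact: ae_U_le_condexp].
have [mV iV VC] := IH i; have [mV1 iV1 VC1] := IH i.+1.
have [mC iC CE] := condexpP (sG i) (@mG i) (integrable_future_sup i).
have [mC1 iC1 CE1] :=
  condexpP (sG i.+1) (@mG i.+1) (integrable_future_sup i.+1).
have [mD iD DE] := condexpP (sG i) (@mG i) iV1.
have UC := ae_U_le_condexp i.
have DC : {ae P, forall w, (condexp P (G i) (value_iter k i.+1) w <=
                            condexp P (G i) (future_sup i) w)%R}.
  apply: (ae_le_of_integral (sG i) (@mG i)) => // A GA.
  have mA := mG GA; rewrite DE // CE //.
  apply: (@le_trans _ _ (\int[P]_(w in A) (future_sup i.+1 w)%:E)).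
    rewrite -CE1; last exact: (subG (leqnSn i)).
    by apply: ae_le_integral => //; apply: filterS VC1.
  apply: ae_le_integral => //; try exact: integrable_future_sup.
  by apply: filterS (ae_future_sup_le (leqnSn i)).
have mVS : measurable_wrt (G i) (value_iter k.+1 i).
  by apply: measurable_wrt_max => //; exact: measurable_wrt_max.
have VSC : {ae P, forall w, (value_iter k.+1 i w <=
                             condexp P (G i) (future_sup i) w)%R}.
  by apply: filterS3 VC UC DC => w a b c /=; rewrite !ge_max a b c.
split => //.
apply: ae_dominated_integrable iC; first exact: (measurable_wrt_fun (sG i)).
by apply: filterS VSC => w H; rewrite ger0_norm ?value_iter_ge0.
Qed.

Definition snell_value i w : R :=
  fine (esups (fun k => (value_iter k i w)%:E) 0%N).

Let esupsVE i w : esups (fun k => (value_iter k i w)%:E) 0%N =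
  ereal_sup (range (fun k => (value_iter k i w)%:E)).
Proof. by congr ereal_sup; apply/seteqP; split=> x [k] _ <-; exists k. Qed.

(** The bound on the iterates does not depend on [k], so their supremum is almost surely finite and
    [fine] loses nothing. *)
Lemma ae_snell_valueE : {ae P, forall w i,
  [/\ (snell_value i w)%:E = ereal_sup (range (fun k => (value_iter k i w)%:E)),
      forall k, (value_iter k i w <= snell_value i w)%R &
      (snell_value i w <= condexp P (G i) (future_sup i) w)%R]}.
Proof.
apply: ae_foralln => i.
have : {ae P, forall w k,
    (value_iter k i w <= condexp P (G i) (future_sup i) w)%R}.
  by apply: ae_foralln => k; have [] := value_iter_bound k i.
apply: filterS => w VC; set C := condexp _ _ _ _ in VC *.
have supC : ereal_sup (range (fun k => (value_iter k i w)%:E)) <= C%:E.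
  by apply: ge_ereal_sup => _ [k _ <-]; rewrite lee_fin.
have Vsup k : (value_iter k i w)%:E <=
    ereal_sup (range (fun k => (value_iter k i w)%:E)).
  by apply: ereal_sup_ubound; exists k.
have fin : ereal_sup (range (fun k => (value_iter k i w)%:E)) \is a fin_num.
  rewrite ge0_fin_numE; first by rewrite (le_lt_trans supC) ?ltry.
  by rewrite (le_trans _ (Vsup 0%N)) // lee_fin value_iter_ge0.
have E : (snell_value i w)%:E =
    ereal_sup (range (fun k => (value_iter k i w)%:E)).
  by rewrite /snell_value esupsVE fineK.
by split => // [k|]; rewrite -lee_fin E.
Qed.

Lemma snell_value_ge0 i w : (0 <= snell_value i w)%R.
Proof.
rewrite fine_ge0 // (@le_trans _ _ (value_iter 0 i w)%:E) //.
  by rewrite lee_fin value_iter_ge0.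
by apply: ereal_sup_ubound; exists 0%N.
Qed.

Lemma measurable_snell_value i : measurable_wrt (G i) (snell_value i).
Proof.
have mV k : measurable_wrt (G i) (value_iter k i).
  by have [] := value_iter_bound k i.
apply: (measurableT_comp (@fine_measurable R setT measurableT)).
apply: (@measurable_fun_esups _ (g_sigma_algebraType (G i)) _ setT
  (fun k w => (value_iter k i w)%:E)) => k.
by apply/measurable_EFinP; exact: mV.
Qed.

Lemma integrable_snell_value i : integrable_rv P (snell_value i).
Proof.
have [mC iC CE] := condexpP (sG i) (@mG i) (integrable_future_sup i).
apply: ae_dominated_integrable iC.
  exact: (measurable_wrt_fun (sG i) (@mG i) (@measurable_snell_value i)).
apply: filterS ae_snell_valueE => w /(_ i)[_ _].
by rewrite ger0_norm ?snell_value_ge0.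
Qed.

(** Monotone convergence in [k]; the iterates increase at every point of [A]. *)
Lemma integral_snell_value_le i A c : measurable A ->
  (forall k, \int[P]_(w in A) (value_iter k i w)%:E <= c) ->
  \int[P]_(w in A) (snell_value i w)%:E <= c.
Proof.
move=> mA Vc.
have mV k : measurable_fun A (fun w => (value_iter k i w)%:E).
  apply/measurable_EFinP/measurable_funTS/(measurable_wrt_fun (sG i) (@mG i)).
  by have [] := value_iter_bound k i.
have V0 k w : A w -> 0 <= (value_iter k i w)%:E.
  by rewrite lee_fin value_iter_ge0.
have Vnd w : A w -> nondecreasing_seq (fun k => (value_iter k i w)%:E).
  by move=> _ k l kl; rewrite lee_fin value_iter_nd.
have -> : \int[P]_(w in A) (snell_value i w)%:E =
    \int[P]_(w in A) limn (fun k => (value_iter k i w)%:E).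
  have limE w : A w -> limn (fun k => (value_iter k i w)%:E) =
      ereal_sup (range (fun k => (value_iter k i w)%:E)).
    move=> Aw; apply/cvg_lim => //.
    exact: ereal_nondecreasing_cvgn (Vnd w Aw).
  apply: ae_eq_integral => //.
  - apply/measurable_EFinP/measurable_funTS/(measurable_wrt_fun (sG i) (@mG i)).
    exact: measurable_snell_value.
  - apply: (emeasurable_fun_cvg _ _ mV) => w Aw.
    exact: (ereal_nondecreasing_is_cvgn (Vnd w Aw)).
  - apply: filterS ae_snell_valueE => w /(_ i)[E _ _] Aw.
    by rewrite limE.
rewrite (monotone_convergence P mA mV V0 Vnd).
apply: lime_le; last by apply: nearW.
apply: ereal_nondecreasing_is_cvgn => k l kl.
by apply: ge0_le_integral => // w Aw; [exact: V0|exact: Vnd].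
Qed.

(** The last clause acts as a terminal condition for the recursion. The notion is kept abstract
    because it is used twice: for [snell_value], to identify the Snell envelope, and then for the
    envelope itself. *)
Definition snell_process (Y : nat -> Omega -> R) : Prop := forall i,
  [/\ measurable_wrt (G i) (Y i), integrable_rv P (Y i),
      {ae P, forall w,
        Y i w = Num.max (U i w) (condexp P (G i) (Y i.+1) w)} &
      {ae P, forall w, (Y i w <= condexp P (G i) (future_sup i) w)%R}].

Lemma snell_value_process : snell_process snell_value.
Proof.
move=> i; split.
- exact: measurable_snell_value.
- exact: integrable_snell_value.
- have [mC iC CE] :=
    condexpP (sG i) (@mG i) (integrable_snell_value i.+1).
  (* On events of [G i], each iterate at [i.+1] has integral at most that of the following iterate
     at [i], hence of [snell_value i]; monotone convergence then passes to the limit in [k]. *)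
  have le1 : {ae P, forall w,
      (condexp P (G i) (snell_value i.+1) w <= snell_value i w)%R}.
    apply: (ae_le_of_integral (sG i) (@mG i)) => //.
    + exact: measurable_snell_value.
    + exact: integrable_snell_value.
    move=> A GA; rewrite CE //; have mA := mG GA.
    apply: integral_snell_value_le => // k.
    have [_ iV _] := value_iter_bound k i.+1.
    have [mD iD DE] := condexpP (sG i) (@mG i) iV.
    rewrite -DE //; apply: ae_le_integral => //.
      exact: integrable_snell_value.
    apply: filterS ae_snell_valueE => w /(_ i)[_ /(_ k.+1) + _] _.
    by apply: le_trans => /=; rewrite !le_max lexx !orbT.
  (* Conversely, every iterate stays below the right-hand side, by induction on [k], and therefore
     so does the supremum. *)
  have le2 : {ae P, forall w k, (value_iter k i w <=
      Num.max (U i w) (condexp P (G i) (snell_value i.+1) w))%R}.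
    apply: ae_foralln; elim => [|k IH].
      by apply: aeW => w /=; rewrite le_max lexx.
    have [_ iV _] := value_iter_bound k i.+1.
    have [mD iD DE] := condexpP (sG i) (@mG i) iV.
    have DC : {ae P, forall w, (condexp P (G i) (value_iter k i.+1) w <=
        condexp P (G i) (snell_value i.+1) w)%R}.
      apply: (ae_le_of_integral (sG i) (@mG i)) => // A GA.
      rewrite DE // CE //; apply: ae_le_integral => //; first exact: (mG GA).
        exact: integrable_snell_value.
      by apply: filterS ae_snell_valueE => w /(_ i.+1)[_ /(_ k) + _] _.
    apply: filterS2 IH DC => w IH DC /=.
    by rewrite !ge_max IH le_max lexx /= le_max DC orbT.
  apply: filterS3 le1 le2 ae_snell_valueE => w le1 le2 /(_ i)[E ub _].
  apply/eqP; rewrite eq_le; apply/andP; split; last first.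
    by rewrite ge_max le1 andbT; exact: (ub 0%N).
  rewrite -lee_fin E; apply: ge_ereal_sup => _ [k _ <-].
  by rewrite lee_fin.
- by apply: filterS ae_snell_valueE => w /(_ i)[].
Qed.

End snell.

(** * Stopped processes and the Snell envelope *)

Section vanishing_integral.
Context {d : measure_display} {Omega : measurableType d} {R : realType}.
Variable P : probability Omega R.

(** The integrals over the complements increase to the full integral, which is finite. The lemma
    serves both for the tails of a finite stopping rule and for the tails in uniform
    integrability. *)
Lemma integral_vanish (F : nat -> set Omega) (X : Omega -> R) (e : R) :
  (forall j, measurable (F j)) -> (forall i j, (i <= j)%N -> F j `<=` F i) ->
  (forall w, exists j, ~ F j w) -> integrable_rv P X ->
  (forall w, (0 <= X w)%R) -> (0 < e)%R ->
  exists j, \int[P]_(w in F j) (X w)%:E <= e%:E.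
Proof.
move=> mF ndF F0 iX X0 e0; apply: contrapT => /forallNP eF.
have mX := integrable_rv_measurable iX.
have := @ge0_nondecreasing_set_cvg_integral _ Omega R (fun j => ~` F j)
  (EFin \o X) P.
rewrite (_ : \bigcup_i ~` F i = setT); last first.
  by apply/seteqP; split=> // w _; have [j] := F0 w; exists j.
have fX := integral_rv_fin measurableT iX.
have h : \int[P]_w (X w)%:E - e%:E < \int[P]_w (X w)%:E.
  by rewrite lteBlDr // lteDl // lte_fin.
move=> cv; move: h; rewrite ltNge => /negP; apply.
apply: (cvge_le _ (cv _ _ _ _)).
- apply: nearW => j; rewrite leeBrDr //.
  rewrite [leRHS](integral_split measurableT (mF j)) //.
  rewrite setTI setTD [leLHS]addeC; apply: leeD2r.
  by apply/ltW; rewrite ltNge; exact/negP/eF.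
- move=> i j ij; rewrite subsetEset; apply: subsetC; exact: ndF.
- by move=> j; exact: measurableC.
- by move=> j; exact/measurable_EFinP/measurable_funTS.
- by move=> j w _; rewrite lee_fin.
Qed.
End vanishing_integral.

(** * Optional stopping for truncated rules *)

Section stopping.
Context {d : measure_display} {Omega : measurableType d} {R : realType}.
Variables (P : probability Omega R) (G : nat -> set (set Omega)).
Hypothesis cG : forall i, complete_sub_sigma P (G i).
Hypothesis subG : forall i j, (i <= j)%N -> G i `<=` G j.

Let sG i : sigma_algebra setT (G i). Proof. by have [] := cG i. Qed.
Let mG i : G i `<=` measurable. Proof. by have [] := cG i. Qed.

Definition stopped (X : nat -> Omega -> R) (n : Omega -> nat) (j : nat) :
  Omega -> R := fun w => X (minn (n w) j) w.

Lemma stopping_rule_le n j : stopping_rule G n -> G j [set w | (n w <= j)%N].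
Proof.
move=> nG; elim: j => [|j IH].
  rewrite (_ : [set w | (n w <= 0)%N] = [set w | n w = 0%N]); first exact: nG.
  by apply/seteqP; split=> w /=; rewrite leqn0 => /eqP.
rewrite (_ : [set w | (n w <= j.+1)%N] =
    [set w | (n w <= j)%N] `|` [set w | n w = j.+1]).
  by apply: (sigma_setU (sG _)); [exact: (subG (leqnSn j))|exact: nG].
apply/seteqP; split=> w /=.
  by rewrite leq_eqVlt => /orP[/eqP|]; [right|left].
by move=> [/leqW//|->].
Qed.

Lemma stopping_rule_gt n j : stopping_rule G n -> G j [set w | (j < n w)%N].
Proof.
move=> /(stopping_rule_le j)/(sigma_setC (sG j)).
rewrite (_ : ~` _ = [set w | (j < n w)%N]) //.
by apply/seteqP; split=> w /=; rewrite ltnNge => /negP.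
Qed.

Variables (X : nat -> Omega -> R) (n : Omega -> nat).
Hypothesis iX : forall i, integrable_rv P (X i).
Hypothesis nG : stopping_rule G n.

Let mX i : measurable_fun setT (X i).
Proof. exact: integrable_rv_measurable. Qed.

Let mle j : measurable [set w | (n w <= j)%N].
Proof. exact: (mG (stopping_rule_le j nG)). Qed.

Lemma measurable_at_rule : measurable_fun setT (at_rule X n).
Proof.
move=> _ B mB; rewrite setTI.
rewrite (_ : _ @^-1` B = \bigcup_k ([set w | n w = k] `&` (X k @^-1` B))).
  apply: bigcupT_measurable => k; apply: measurableI.
    exact: (mG (nG k)).
  by rewrite -[_ @^-1` _]setTI; exact: mX.
apply/seteqP; split=> w; rewrite /at_rule /=; first by exists (n w).
by move=> [k _ [<-]].
Qed.

Lemma stoppedS j w : stopped X n j.+1 w =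
  if (j < n w)%N then X j.+1 w else stopped X n j w.
Proof.
rewrite /stopped; case: ltnP => h; first by rewrite (minn_idPr _).
by rewrite !(minn_idPl _) //; exact: leqW.
Qed.

Lemma integrable_stopped j : integrable_rv P (stopped X n j).
Proof.
have s0 : stopped X n 0 = X 0%N by apply/funext => w; rewrite /stopped minn0.
have mS k : measurable_fun setT (stopped X n k).
  elim: k => [|k IH]; first by rewrite s0.
  rewrite (_ : stopped X n k.+1 = fun w =>
      if (k < n w)%N then X k.+1 w else stopped X n k w).
    apply: measurable_fun_ifT => //.
    apply: (measurable_fun_bool true); rewrite setTI.
    exact: (mG (stopping_rule_gt k nG)).
  by apply/funext => w; rewrite stoppedS.
elim: j => [|j IH]; first by rewrite s0.
apply: (@ae_dominated_integrable _ _ _ _ _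
   ((fun w => `|X j.+1 w|) \+ (fun w => `|stopped X n j w|))%R) => //.
  apply: aeW => w /=; rewrite stoppedS.
  by case: ifP => _; rewrite ?lerDl ?lerDr.
by apply: integrable_rvD; exact: integrable_rv_norm.
Qed.

(** Passing from [l] to [l.+1] changes the stopped process only on [l < n], an event of [G l]. The
    relation [r] is a parameter so that supermartingales ([<=]) and martingales (equality) share the
    proof. The one-step hypothesis concerns only events on which [n] has not yet stopped, since the
    Snell process is a martingale only there. *)
Lemma stopped_integral_rel (r : rel (\bar R)) i A :
  reflexive r -> transitive r ->
  (forall a b c, r b c -> r (a + b) (a + c)) ->
  (forall w, (i <= n w)%N) -> G i A ->
  (forall j B, (i <= j)%N -> G j B -> (forall w, B w -> (j < n w)%N) ->
    r (\int[P]_(w in B) (X j.+1 w)%:E) (\int[P]_(w in B) (X j w)%:E)) ->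
  forall j, (i <= j)%N ->
    r (\int[P]_(w in A) (stopped X n j w)%:E) (\int[P]_(w in A) (X i w)%:E).
Proof.
move=> rr tr addr ni GA step j /subnK <-; elim: (j - i)%N => [|k IH].
  rewrite add0n; under eq_integral do rewrite /stopped (minn_idPr _) //.
  exact: rr.
apply: tr IH; rewrite addSn; set l := (k + i)%N.
have il : (i <= l)%N by rewrite leq_addl.
have mA := mG GA.
rewrite (integral_split mA (mle l)) //; last exact: integrable_stopped.
rewrite [X in r _ X](integral_split mA (mle l)) //; last first.
  exact: integrable_stopped.
have -> : \int[P]_(w in A `&` [set w | (n w <= l)%N]) (stopped X n l.+1 w)%:E =
          \int[P]_(w in A `&` [set w | (n w <= l)%N]) (stopped X n l w)%:E.
  by apply: eq_integral => w /set_mem[_ /= nl]; rewrite stoppedS ltnNge nl.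
apply: addr.
have E (k' : nat) : (l <= k' <= l.+1)%N ->
    \int[P]_(w in A `\` [set w | (n w <= l)%N]) (stopped X n k' w)%:E =
    \int[P]_(w in A `\` [set w | (n w <= l)%N]) (X k' w)%:E.
  move=> /andP[lk' k'l]; apply: eq_integral => w /set_mem[_ /= /negP].
  by rewrite -ltnNge => nl; rewrite /stopped (minn_idPr _) // (leq_trans k'l).
rewrite !E ?leqnn ?leqnSn //; apply: step => //.
  rewrite setDE; apply: (sigma_setI (sG _)); first exact: (subG il).
  by apply: (sigma_setC (sG _)); exact: stopping_rule_le.
by move=> w [_ /= /negP]; rewrite -ltnNge.
Qed.

End stopping.

(** * Optimality of the first contact and identification of the Snell envelope *)

Section snell_optimal.
Context {d : measure_display} {Omega : measurableType d} {R : realType}.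
Variables (P : probability Omega R) (G : nat -> set (set Omega)).
Variable U : nat -> Omega -> R.
Hypothesis cG : forall i, complete_sub_sigma P (G i).
Hypothesis subG : forall i j, (i <= j)%N -> G i `<=` G j.
Hypothesis mU : forall i, measurable_wrt (G i) (U i).
Hypothesis U_ge0 : forall i w, (0 <= U i w)%R.
Hypothesis int_supU :
  \int[P]_w ereal_sup [set (U i w)%:E | i in [set: nat]] < +oo.
(** [D i] is an event, known at index [i], on which the reward is over; for the sampled problem it
    says that the time of index [i] exceeds [T]. *)
Variable D : nat -> set Omega.
Hypothesis GD : forall i, G i (D i).
Hypothesis D_dead :
  {ae P, forall w i j, (i <= j)%N -> D i w -> U j w = 0%R}.
Hypothesis D_ev : {ae P, forall w, exists k, forall j, (k <= j)%N -> D j w}.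

Let sG i : sigma_algebra setT (G i). Proof. by have [] := cG i. Qed.
Let mG i : G i `<=` measurable. Proof. by have [] := cG i. Qed.
Let iS i : integrable_rv P (future_sup U i).
Proof. exact: (integrable_future_sup cG mU U_ge0 int_supU). Qed.

Variable Y : nat -> Omega -> R.
Hypothesis snellY : snell_process P G U Y.

Let mY i : measurable_wrt (G i) (Y i). Proof. by have [] := snellY i. Qed.
Let iY i : integrable_rv P (Y i). Proof. by have [] := snellY i. Qed.

Lemma snell_condexpP i : is_condexp P (G i) (Y i.+1) (condexp P (G i) (Y i.+1)).
Proof. exact: condexpP. Qed.

Lemma ae_snell_ge : {ae P, forall w i, (U i w <= Y i w)%R}.
Proof.
apply: ae_foralln => i; have [_ _ H _] := snellY i.
by apply: filterS H => w ->; rewrite le_max lexx.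
Qed.

Lemma snell_integral_le i A : G i A ->
  \int[P]_(w in A) (Y i w)%:E <= \int[P]_(w in A) (future_sup U i w)%:E.
Proof.
move=> GA; have [_ _ _ H] := snellY i.
have [mC iC CE] := condexpP (sG i) (@mG i) (iS i).
rewrite -CE //; apply: ae_le_integral => //; first exact: (mG GA).
by apply: filterS H => w H _.
Qed.

Lemma snell_integral_le0 i A : G i A ->
  \int[P]_(w in A) (Y i w)%:E <= \int[P]_(w in A) (future_sup U 0 w)%:E.
Proof.
move=> GA; apply: le_trans (snell_integral_le GA) _.
apply: ae_le_integral => //; first exact: (mG GA).
have := ae_future_sup_le cG mU U_ge0 int_supU (leq0n i).
by apply: filterS => w H _.
Qed.

Lemma snell_supermartingale i A : G i A ->
  \int[P]_(w in A) (Y i.+1 w)%:E <= \int[P]_(w in A) (Y i w)%:E.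
Proof.
move=> GA; have [mC iC CE] := snell_condexpP i.
rewrite -CE //; apply: ae_le_integral => //; first exact: (mG GA).
have [_ _ H _] := snellY i.
by apply: filterS H => w -> _; rewrite le_max lexx orbT.
Qed.

(** Where [U i < Y i], the maximum in the recursion is attained by the conditional expectation. *)
Lemma snell_martingale_on i A : G i A ->
  (forall w, A w -> (U i w < Y i w)%R) ->
  \int[P]_(w in A) (Y i.+1 w)%:E = \int[P]_(w in A) (Y i w)%:E.
Proof.
move=> GA UY; have [mC iC CE] := snell_condexpP i.
apply/eqP; rewrite eq_le snell_supermartingale //= -CE //.
apply: ae_le_integral => //; first exact: (mG GA).
have [_ _ H _] := snellY i.
apply: filterS H => w H /UY; rewrite H lt_max ltxx /= => UC.
by rewrite ge_max (ltW UC) lexx.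
Qed.

(** On [D i] the future supremum vanishes almost surely, and its integral over [D i] dominates that
    of [Y i], which is nonnegative. *)
Lemma ae_snell_dead : {ae P, forall w i, D i w -> Y i w = 0%R}.
Proof.
apply: ae_foralln => i; have mD := mG (GD i).
have S0 : \int[P]_(w in D i) (future_sup U i w)%:E = 0.
  rewrite (_ : 0 = \int[P]_(w in D i) (cst 0%R w)%:E); last first.
    by rewrite integral0_eq.
  apply: ae_eq_integral => //.
    exact/measurable_funTS/measurable_EFinP/integrable_rv_measurable.
    by apply/measurable_EFinP.
  apply: filterS D_dead => w Dw Di /=.
  rewrite /future_sup (_ : esups _ _ = 0%:E) //.
  apply/eqP; rewrite eq_le; apply/andP; split.
    by apply: ge_ereal_sup => _ [j /= ij <-]; rewrite (Dw _ _ ij Di).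
  apply: ereal_sup_ubound; exists i => //=.
  by rewrite (Dw _ _ (leqnn i) Di).
have Y0 : \int[P]_(w in D i) `|(Y i w)%:E| = 0.
  apply/eqP; rewrite eq_le integral_ge0 // andbT -S0.
  apply: le_trans (snell_integral_le (GD i)).
  apply: (@ae_le_integral _ _ _ P (D i) (fun w => `|Y i w|)%R) => //.
    exact: integrable_rv_norm.
  apply: filterS ae_snell_ge => w /(_ i) H _.
  by rewrite ger0_norm // (le_trans _ H).
have := (ae_eq_integral_abs P mD _).1 Y0.
move=> /(_ (measurable_funTS (measurable_int P (iY i)))).
by apply: filterS => w /= H /H [].
Qed.

(* The value [i] is a convention if there is no such [j], a null event. *)
Definition first_stop i w : nat :=
  if pselect (exists j, (i <= j)%N && (Y j w <= U j w)%R) is left h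
  then ex_minn h else i.

Lemma first_stop_ge i w : (i <= first_stop i w)%N.
Proof.
rewrite /first_stop; case: pselect => // h.
by case: ex_minnP => m /andP[].
Qed.

Lemma first_stop_gt i j w : (i <= j < first_stop i w)%N -> (U j w < Y j w)%R.
Proof.
move=> /andP[ij]; rewrite /first_stop; case: pselect => [h|_]; last first.
  by rewrite ltnNge ij.
case: ex_minnP => m _ mmin jm; rewrite ltNge; apply/negP => YU.
by move: jm; rewrite ltnNge mmin // ij.
Qed.

Lemma ae_first_stop :
  {ae P, forall w i, Y (first_stop i w) w = U (first_stop i w) w}.
Proof.
apply: filterS3 D_ev ae_snell_ge (filterI D_dead ae_snell_dead).
move=> w [k Dk] UY [dead YD] i; apply/eqP; rewrite eq_le UY andbT.
rewrite /first_stop; case: pselect => [h|].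
  by case: ex_minnP => m /andP[].
(* At an index beyond both [i] and [k] the reward is over, so [Y] is 0 and cannot exceed [U]. *)
case; exists (maxn i k); rewrite leq_maxl /=.
have Dm := Dk _ (leq_maxr i k).
by rewrite (YD _ Dm) U_ge0.
Qed.

(** The event [B] of a first contact at [k] visibly lies in [G k]. It can differ from the event
    [first_stop i w = k] only where the default value is taken, and completeness of [G k] absorbs
    this null set. *)
Lemma first_stop_rule i : stopping_rule G (first_stop i).
Proof.
move=> k; pose B := [set w | (i <= k)%N /\ (Y k w <= U k w)%R] `&`
   \bigcap_(j in [set j | (i <= j < k)%N]) [set w | (U j w < Y j w)%R].
apply: (@complete_sub_sigma_ae_eqset _ _ _ P _ B) => //.
  apply: filterS ae_first_stop => w fs; split.
    move=> [[ik YUk] UYj]; rewrite /= /first_stop; case: pselect => [h|[]].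
      case: ex_minnP => m /andP[im YUm] mmin; apply/eqP.
      rewrite eqn_leq mmin ?ik //= leqNgt; apply/negP => mk.
      have /= := UYj m; rewrite im mk => /(_ isT).
      by rewrite ltNge YUm.
    by exists k; rewrite ik.
  move=> /= E; rewrite /B -E; split.
    by split; [exact: first_stop_ge|rewrite fs].
  by move=> j /= /first_stop_gt.
apply: (sigma_setI (sG k)).
  have [ik|ik] := boolP (i <= k)%N; last first.
    have -> : [set w | false /\ (Y k w <= U k w)%R] = set0.
      by apply/seteqP; split=> w //= [].
    by case: (sG k).
  have -> : [set w | true /\ (Y k w <= U k w)%R] =
      ~` [set w | (U k w < Y k w)%R].
    apply/seteqP; split => w /=; rewrite ltNge; first by move=> [_ ->].
    by move=> /negP; rewrite negbK.
  by apply: (sigma_setC (sG k)); exact: sigma_ltr.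
have -> : \bigcap_(j in [set j | (i <= j < k)%N]) [set w | (U j w < Y j w)%R] =
   ~` \bigcup_j (if (i <= j < k)%N
     then ~` [set w | (U j w < Y j w)%R] else set0).
  rewrite setC_bigcup; apply/seteqP; split=> w H j.
    by move=> _; case: ifP => [ij|_] //; rewrite setCK; exact: H.
  by move=> /= ij; have := H j I; rewrite ij setCK.
apply: (sigma_setC (sG k)).
have [_ _ Gcup] := sG k; apply: Gcup => j.
case: ifP => [/andP[ij jk]|_]; last by case: (sG k).
apply: (sigma_setC (sG k)); apply: (subG (ltnW jk)).
exact: sigma_ltr.
Qed.

Lemma integrable_at_rule n : stopping_rule G n -> integrable_rv P (at_rule U n).
Proof.
move=> nG; apply: ae_dominated_integrable (iS 0).
  apply: (measurable_at_rule cG _ nG) => k.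
  exact: (integrable_U cG mU U_ge0 int_supU).
apply: filterS (ae_le_future_sup cG mU U_ge0 int_supU) => w H.
by rewrite ger0_norm ?U_ge0 // H.
Qed.

(** The process [Y] stopped at [min n j] has integral over [A] at most that of [Y i], and on
    [n <= j] it dominates the reward at [n]. Monotone convergence along these events removes the
    truncation. *)
Lemma snell_ge_at_rule i n A : stopping_rule G n ->
  (forall w, (i <= n w)%N) -> G i A ->
  \int[P]_(w in A) (at_rule U n w)%:E <= \int[P]_(w in A) (Y i w)%:E.
Proof.
move=> nG ni GA; have mA := mG GA; have iUn := integrable_at_rule nG.
have mle j : measurable [set w | (n w <= j)%N].
  exact: (mG (stopping_rule_le cG subG j nG)).
have := @ge0_nondecreasing_set_cvg_integral _ Omega R
  (fun j => A `&` [set w | (n w <= j)%N]) (EFin \o at_rule U n) P.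
have -> : \bigcup_j (A `&` [set w | (n w <= j)%N]) = A.
  apply/seteqP; split=> [w [j _ []]//|w Aw].
  by exists (n w) => //; split => //=.
move=> cv; apply: (cvge_le _ (cv _ _ _ _)).
- near=> j.
  have ij : (i <= j)%N by near: j; exists i.
  have mAj : measurable (A `&` [set w | (n w <= j)%N]) by exact: measurableI.
  have mAj' : measurable (A `\` [set w | (n w <= j)%N]) by exact: measurableD.
  have iSt : integrable_rv P (stopped Y n j).
    exact: (integrable_stopped cG subG iY nG).
  have St_le : \int[P]_(w in A) (stopped Y n j w)%:E <=
      \int[P]_(w in A) (Y i w)%:E.
    apply: (stopped_integral_rel cG subG iY nG (r := <=%O) (i := i)) => //.
    + exact: le_trans.
    + by move=> a b c; exact: leeD2l.
    + by move=> k B _ GB _; exact: snell_supermartingale.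
  apply: le_trans St_le.
  rewrite [leRHS](integral_split mA (mle j)) //.
  apply: (@le_trans _ _
      (\int[P]_(w in A `&` [set w | (n w <= j)%N]) (stopped Y n j w)%:E)).
    apply: ae_le_integral => //.
    apply: filterS ae_snell_ge => w UY [_ /= nj].
    by rewrite /stopped (minn_idPl nj); exact: UY.
  rewrite leeDl //; apply: ae_integral_ge0 => //.
  by apply: filterS ae_snell_ge => w H; exact: le_trans (H _).
- move=> a b ab; rewrite subsetEset => w [Aw /= na]; split=> //=.
  exact: leq_trans ab.
- by move=> j; exact: measurableI.
- by move=> j; exact: (measurable_funTS (measurable_int P iUn)).
- by move=> j w _; rewrite lee_fin U_ge0.
Unshelve. all: by end_near. Qed.

(** Up to the first contact the stopped process is a martingale, so the integral of [Y i] splits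
    into the part [n <= j], where [Y] equals [U] at [n], and a remainder on [j < n]. The remainder
    is at most the integral of [future_sup U 0] over [j < n], small for large [j] because [n] is
    finite. *)
Lemma snell_le_first_stop i A : G i A ->
  \int[P]_(w in A) (Y i w)%:E <=
  \int[P]_(w in A) (at_rule U (first_stop i) w)%:E.
Proof.
move=> GA; have mA := mG GA; set n := first_stop i.
have nG : stopping_rule G n := first_stop_rule i.
have iUn := integrable_at_rule nG.
have mgt j : measurable [set w | (j < n w)%N].
  exact: (mG (stopping_rule_gt cG subG j nG)).
rewrite -[leRHS]adde0; apply/lee_addgt0Pr => e e0; rewrite adde0.
have [] := @integral_vanish _ Omega R P (fun j => [set w | (j < n w)%N])
   (future_sup U 0) e.
- by [].
- by move=> a b ab w /=; exact: leq_ltn_trans.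
- by move=> w; exists (n w); rewrite /= ltnn.
- exact: iS.
- by move=> w; exact: (future_sup_ge0 U_ge0).
- exact: e0.
(* The truncation index must also be at least [i]: the stopped process is compared with [Y i], and
   [A] has to lie in [G j]. *)
move=> j0 Hj0; pose j := maxn i j0.
have Hj : \int[P]_(w in [set w | (j < n w)%N]) (future_sup U 0 w)%:E <= e%:E.
  apply: le_trans Hj0; apply: ge0_subset_integral => //.
  - exact: (measurable_funTS (measurable_int P (iS 0))).
  - by move=> w _; rewrite lee_fin (future_sup_ge0 U_ge0).
  - by move=> w /=; apply: leq_ltn_trans; rewrite leq_maxr.
have <- : \int[P]_(w in A) (stopped Y n j w)%:E = \int[P]_(w in A) (Y i w)%:E.
  apply/eqP;
    apply: (stopped_integral_rel cG subG iY nG (r := eq_op) (i := i)) => //.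
  - exact: eq_op_trans.
  - by move=> a b c /eqP ->.
  - exact: first_stop_ge.
  - move=> k B ik GB kn; apply/eqP; apply: snell_martingale_on => // w Bw.
    by apply: (@first_stop_gt i); rewrite ik kn.
  - by rewrite leq_maxl.
have iSt : integrable_rv P (stopped Y n j).
  exact: (integrable_stopped cG subG iY nG).
have mAj : measurable (A `&` [set w | (j < n w)%N]) by exact: measurableI.
have mAj' : measurable (A `\` [set w | (j < n w)%N]) by exact: measurableD.
rewrite (integral_split mA (mgt j)) // addeC; apply: leeD.
  rewrite [leRHS](integral_split mA (mgt j)) // -[leLHS]add0e; apply: leeD.
    by apply: integral_ge0 => w _; rewrite lee_fin U_ge0.
  apply: ae_le_integral => //.
  apply: filterS ae_first_stop => w E [_ /= /negP]; rewrite -leqNgt => nj.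
  by rewrite /stopped (minn_idPl nj) /at_rule E.
have -> : \int[P]_(w in A `&` [set w | (j < n w)%N]) (stopped Y n j w)%:E =
          \int[P]_(w in A `&` [set w | (j < n w)%N]) (Y j w)%:E.
  apply: eq_integral => w /set_mem[_ /= nj].
  by rewrite /stopped (minn_idPr (ltnW nj)).
apply: le_trans (snell_integral_le0 _) _.
  apply: (sigma_setI (sG j)); last exact: stopping_rule_gt.
  by apply: (subG _ GA); rewrite leq_maxl.
apply: le_trans Hj; apply: ge0_subset_integral => //.
- exact: (measurable_funTS (measurable_int P (iS 0))).
- by move=> w _; rewrite lee_fin (future_sup_ge0 U_ge0).
Qed.

Lemma condexp_first_stop i :
  {ae P, forall w, condexp P (G i) (at_rule U (first_stop i)) w = Y i w}.
Proof.
apply: condexp_ae => //; split=> // A GA.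
apply/eqP; rewrite eq_le snell_le_first_stop //= snell_ge_at_rule //.
  exact: first_stop_rule.
exact: first_stop_ge.
Qed.

(** The family has a greatest element, its member at [first_stop i], which is almost surely [Y i];
    this replaces the usual extraction of a countable subfamily. *)
Lemma snell_ess_sup i : is_ess_sup_family P
  [set condexp P (G i) (at_rule U n)
     | n in [set n | stopping_rule G n /\ forall w, (i <= n w)%N]] (Y i).
Proof.
split; first exact: integrable_rv_measurable.
- move=> _ [n [nG ni] <-].
  have [mC iC CE] := condexpP (sG i) (@mG i) (integrable_at_rule nG).
  apply: (ae_le_of_integral (sG i) (@mG i)) => // A GA.
  by rewrite CE // snell_ge_at_rule.
- move=> Y' mY' H.
  have := H (condexp P (G i) (at_rule U (first_stop i))).
  have /[swap] /[apply] : [set condexp P (G i) (at_rule U n)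
     | n in [set n | stopping_rule G n /\ forall w, (i <= n w)%N]]
     (condexp P (G i) (at_rule U (first_stop i))).
    exists (first_stop i) => //; split; first exact: first_stop_rule.
    exact: first_stop_ge.
  by apply: filterS2 (condexp_first_stop i) => w ->.
Qed.

Lemma ae_snell_envelope i : {ae P, forall w, snell_envelope P G U i w = Y i w}.
Proof.
have := snell_ess_sup i; set Phi := [set _ | _ in _] => YE.
have [mS Sub Smin] : is_ess_sup_family P Phi (snell_envelope P G U i).
  by apply: xgetPex; exists (Y i).
have [_ Yub Ymin] := YE.
have h1 := Smin _ (integrable_rv_measurable (iY i)) Yub.
have h2 := Ymin _ mS Sub.
by apply: filterS2 h1 h2 => w a b; apply/eqP; rewrite eq_le a b.
Qed.

End snell_optimal.

(** * Martingales and duality *)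

Section doob.
Context {d : measure_display} {Omega : measurableType d} {R : realType}.
Variables (P : probability Omega R) (G : nat -> set (set Omega)).
Variable U : nat -> Omega -> R.
Hypothesis cG : forall i, complete_sub_sigma P (G i).
Hypothesis subG : forall i j, (i <= j)%N -> G i `<=` G j.

Let sG i : sigma_algebra setT (G i). Proof. by have [] := cG i. Qed.
Let mG i : G i `<=` measurable. Proof. by have [] := cG i. Qed.

(* On [C = {2 L <= |X i|}], splitting according to [W > L] gives
   [\int_C |X i| <= \int_C W <= e / 2 + 1 / 2 \int_C |X i|]. *)
Lemma uniformly_integrable_dominated (X : nat -> Omega -> R) (W : Omega -> R) :
  (forall i, measurable_wrt (G i) (X i)) ->
  (forall i, integrable_rv P (X i)) -> integrable_rv P W ->
  (forall w, (0 <= W w)%R) ->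
  (forall i C, G i C ->
     \int[P]_(w in C) `|X i w|%:E <= \int[P]_(w in C) (W w)%:E) ->
  uniformly_integrable P X.
Proof.
move=> mX iX iW W0 XW e e0.
have mW := integrable_rv_measurable iW.
have mF (j : nat) : measurable [set w | (j%:R < W w)%R].
  have mt : measurable [set true] by [].
  have mj : measurable_fun setT (cst j%:R : Omega -> R) by [].
  have := measurable_fun_ltr mj mW.
  by move=> /(_ measurableT _ mt); rewrite setTI.
have [] := @integral_vanish _ Omega R P (fun j => [set w | (j%:R < W w)%R])
  W (e / 2)%R.
- exact: mF.
- by move=> i j ij w /=; apply: le_lt_trans; rewrite ler_nat.
- move=> w; exists (Num.bound (W w)) => /=; apply/negP; rewrite -leNgt.
  by apply/ltW/archi_boundP.
- exact: iW.
- exact: W0.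
- by rewrite divr_gt0.
move=> L HL; exists (2 * L%:R)%R => i.
set C := [set w | _].
have GC : G i C.
  rewrite (_ : C = ~` [set w | (`|X i w| < 2 * L%:R)%R]).
    apply: (sigma_setC (sG i)); apply: (sigma_ltr (sG i)).
      by apply: measurableT_comp => //; exact: mX.
    exact: measurable_cst.
  by apply/seteqP; split=> w; rewrite /C /= leNgt => /negP.
have mC := mG GC; have iXi := integrable_rv_norm (iX i).
apply: le_trans (XW i C GC) _.
have fC := integral_rv_fin mC iXi.
have fCW := integral_rv_fin mC iW.
have mCL : measurable (C `\` [set w | (L%:R < W w)%R]) by exact: measurableD.
have H1 : \int[P]_(w in C) (W w)%:E <=
    (e / 2)%:E + \int[P]_(w in C) (`|X i w| * 2^-1)%:E.
  rewrite (integral_split mC (mF L)) //; apply: leeD.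
    apply: le_trans HL; apply: ge0_subset_integral => //.
    - exact: measurableI.
    - exact: (measurable_funTS (measurable_int P iW)).
    - by move=> w _; rewrite lee_fin.
  apply: (@le_trans _ _ (\int[P]_(w in C `\` [set w | (L%:R < W w)%R])
     (`|X i w| * 2^-1)%:E)).
    apply: ge0_le_integral => //.
    - by move=> w _; rewrite lee_fin.
    - exact: (measurable_funTS (measurable_int P iW)).
    - apply/measurable_EFinP/measurable_funTS/measurable_funM => //.
      exact: (integrable_rv_measurable iXi).
    - move=> w [/= Cw /negP]; rewrite -leNgt => WL; rewrite lee_fin.
      by rewrite (le_trans WL) // ler_pdivlMr // mulrC.
  apply: ge0_subset_integral => //.
  apply/measurable_EFinP/measurable_funTS/measurable_funM => //.
  exact: (integrable_rv_measurable iXi).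
have E1 : \int[P]_(w in C) (`|X i w| * 2^-1)%:E =
    \int[P]_(w in C) `|X i w|%:E * (2^-1)%:E.
  by rewrite -integralZr //; exact: integrable_rvS.
have H2 := XW i C GC.
move: H1 H2; rewrite E1 -(fineK fC) -(fineK fCW) -EFinM -EFinD !lee_fin.
set a := fine _; set b := fine _; lra.
Qed.

Lemma martingale_integral M i A : martingale P G M -> G i A ->
  \int[P]_(w in A) (M i.+1 w)%:E = \int[P]_(w in A) (M i w)%:E.
Proof.
move=> [mM iM MM] GA; have mA := mG GA.
have [mC iC CE] := condexpP (sG i) (@mG i) (iM i.+1).
rewrite -CE //; apply: ae_eq_integral_rv => //.
- exact: (integrable_rv_measurable iC).
- exact: (integrable_rv_measurable (iM i)).
- exact: MM.
Qed.

(* As [U >= 0], it suffices to bound the integral of [U] at the truncated rules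
   [min n j], so that optional stopping is only needed for bounded rules. *)
Lemma weak_duality M n : (forall i, integrable_rv P (U i)) ->
  (forall i w, (0 <= U i w)%R) -> UI_martingale0 P G M ->
  stopping_rule G n ->
  \int[P]_w (at_rule U n w)%:E <=
  \int[P]_w ereal_sup [set (U i w - M i w)%:E | i in [set: nat]].
Proof.
move=> iU U0 [MM _ M0] nG; have [mM iM _] := MM.
pose Ds w := ereal_sup [set (U i w - M i w)%:E | i in [set: nat]].
have mDs : measurable_fun setT Ds.
  apply: (@measurable_ereal_sup _ _ _ (fun i => U i \- M i)%R) => i.
  apply: measurable_funB; first exact: (integrable_rv_measurable (iU i)).
  exact: (integrable_rv_measurable (iM i)).
have Dle i w : (U i w - M i w)%:E <= Ds w.
  by apply: ereal_sup_ubound; exists i.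
have mDp : measurable_fun setT (Ds^\+) := measurable_funepos mDs.
(* The supremum is almost surely nonnegative, since the term of index 0 is [U 0 - 0]. Passing to the
   positive part makes this hold everywhere; if its integral is infinite, the claim is trivial. *)
rewrite -/(Ds _) (_ : \int[P]_w Ds w = \int[P]_w Ds^\+ w); last first.
  apply: ae_eq_integral => //; apply: filterS M0 => w Mw _; rewrite funeposE.
  by rewrite max_l // (le_trans _ (Dle 0%N w)) // lee_fin Mw subr0.
have [->|Dfin] := eqVneq (\int[P]_w Ds^\+ w) +oo; first by rewrite leey.
have iDp : P.-integrable setT (Ds^\+).
  apply/integrableP; split => //.
  under eq_integral do rewrite gee0_abs //.
  by rewrite ltey.
pose Dr := fine \o Ds^\+.
have DrE : {ae P, forall w, (Dr w)%:E = Ds^\+ w}.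
  have := integrable_ae measurableT iDp; apply: filterS => w /(_ I) fin.
  by rewrite /Dr /= fineK.
have mDr : measurable_fun setT Dr.
  exact: (measurableT_comp (@fine_measurable R setT measurableT)).
have intDr : \int[P]_w (Dr w)%:E = \int[P]_w Ds^\+ w.
  apply: ae_eq_integral => //; first exact/measurable_EFinP.
  by apply: filterS DrE => w ->.
have iDr : integrable_rv P Dr.
  apply/integrableP; split; first exact/measurable_EFinP.
  rewrite (_ : \int[P]_w _ = \int[P]_w Ds^\+ w) ?ltey // -intDr.
  by apply: eq_integral => w _; rewrite gee0_abs // lee_fin fine_ge0.
rewrite -intDr.
have mle j : measurable [set w | (n w <= j)%N].
  exact: (mG (stopping_rule_le cG subG j nG)).
have mUn := measurable_at_rule cG iU nG.
have := @ge0_nondecreasing_set_cvg_integral _ Omega R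
  (fun j => [set w | (n w <= j)%N]) (EFin \o at_rule U n) P.
have -> : \bigcup_j [set w | (n w <= j)%N] = setT.
  by apply/seteqP; split=> // w _; exists (n w) => /=.
move=> cv; apply: (cvge_le _ (cv _ _ _ _)).
- apply: nearW => j.
  have iSU := integrable_stopped cG subG iU nG j.
  have iSM := integrable_stopped cG subG iM nG j.
  (* The stopped martingale has mean 0, so adding it changes nothing; the stopped reward is then
     almost surely below the integrand. *)
  have -> : \int[P]_w (Dr w)%:E = \int[P]_w ((Dr \+ stopped M n j)%R w)%:E.
    rewrite integral_rvD //.
    rewrite [X in _ = _ + X](_ : _ = \int[P]_w (M 0%N w)%:E).
      rewrite [X in _ = _ + X](_ : _ = 0) ?adde0 // -(integral0 P setT).
      apply: (ae_eq_integral_rv (Y := cst 0%R)) => //.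
      exact: (integrable_rv_measurable (iM 0%N)).
    apply/eqP.
    apply: (stopped_integral_rel cG subG iM nG (r := eq_op) (i := 0%N)) => //.
    + exact: eq_op_trans.
    + by move=> a b c /eqP ->.
    + by have [] := sG 0; move=> h0 hC _; rewrite -(setD0 setT); exact: hC.
    + by move=> k B _ GB _; apply/eqP; exact: martingale_integral.
  apply: (@le_trans _ _ (\int[P]_w (stopped U n j w)%:E)).
    rewrite [leLHS](_ : _ =
        \int[P]_(w in [set w | (n w <= j)%N]) (stopped U n j w)%:E); last first.
      apply: eq_integral => w /set_mem /= nj.
      by rewrite /stopped (minn_idPl nj).
    apply: ge0_subset_integral => //; first exact: (measurable_int P iSU).
    by move=> w _; rewrite lee_fin; exact: U0.
  apply: ae_le_integral => //; first exact: integrable_rvD.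
  apply: filterS DrE => w DrE _; rewrite -lee_fin /= EFinD DrE.
  rewrite -leeBlDr // (le_trans (Dle _ w)) // funeposE le_max lexx //.
- by move=> a b ab; rewrite subsetEset => w /= na; exact: leq_trans ab.
- exact: mle.
- by move=> j; exact/measurable_EFinP/measurable_funTS.
- by move=> j w _; rewrite lee_fin; exact: U0.
Qed.

End doob.

(** * The Doob martingale of the Snell process *)

Section doob_snell.
Context {d : measure_display} {Omega : measurableType d} {R : realType}.
Variables (P : probability Omega R) (G : nat -> set (set Omega)).
Variable U : nat -> Omega -> R.
Hypothesis cG : forall i, complete_sub_sigma P (G i).
Hypothesis subG : forall i j, (i <= j)%N -> G i `<=` G j.
Hypothesis mU : forall i, measurable_wrt (G i) (U i).
Hypothesis U_ge0 : forall i w, (0 <= U i w)%R.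
Hypothesis int_supU :
  \int[P]_w ereal_sup [set (U i w)%:E | i in [set: nat]] < +oo.

Let sG i : sigma_algebra setT (G i). Proof. by have [] := cG i. Qed.
Let mG i : G i `<=` measurable. Proof. by have [] := cG i. Qed.
Let iS i : integrable_rv P (future_sup U i).
Proof. exact: (integrable_future_sup cG mU U_ge0 int_supU). Qed.

Let GT i : G i setT.
Proof. by have [h0 hC _] := sG i; rewrite -(setD0 setT); exact: hC. Qed.

Variable Y : nat -> Omega -> R.
Hypothesis snellY : snell_process P G U Y.

Let mY i : measurable_wrt (G i) (Y i). Proof. by have [] := snellY i. Qed.
Let iY i : integrable_rv P (Y i). Proof. by have [] := snellY i. Qed.
Let CP i : is_condexp P (G i) (Y i.+1) (condexp P (G i) (Y i.+1)).
Proof. exact: condexpP. Qed.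
Let C i := condexp P (G i) (Y i.+1).
Let mC i : measurable_wrt (G i) (C i). Proof. by have [] := CP i. Qed.
Let iC i : integrable_rv P (C i). Proof. by have [] := CP i. Qed.
Local Notation M := (doob_martingale P G Y).

Lemma doob_martingale0 : M 0 = cst 0%R.
Proof. by apply/funext => w; rewrite /doob_martingale big_geq. Qed.

Lemma doob_martingaleS i : M i.+1 = (M i \+ (Y i.+1 \- C i))%R.
Proof. by apply/funext => w; rewrite /doob_martingale big_nat_recr. Qed.

(** The increments of [M] pair [Y j.+1] with [C j]. Regrouped so that [Y j] meets its own prediction
    [C j], they leave the boundary terms and the compensator, whose terms are almost surely
    nonnegative. *)
Lemma doob_martingaleE i w :
  M i w = (Y i w - Y 0%N w + \sum_(j < i) (Y j w - C j w))%R.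
Proof.
elim: i => [|i IH]; first by rewrite doob_martingale0 big_ord0 subrr addr0.
by rewrite doob_martingaleS big_ord_recr /= IH; lra.
Qed.

Lemma measurable_doob_martingale i : measurable_wrt (G i) (M i).
Proof.
elim: i => [|i IH].
  rewrite doob_martingale0; exact: measurable_cst.
rewrite doob_martingaleS; apply: measurable_wrtD.
  exact: (measurable_wrtS (sG i) (sG i.+1) (subG (leqnSn i)) IH).
apply: measurable_wrtB; first exact: mY.
exact: (measurable_wrtS (sG i) (sG i.+1) (subG (leqnSn i)) (@mC i)).
Qed.

Lemma integrable_doob_martingale i : integrable_rv P (M i).
Proof.
elim: i => [|i IH].
  by rewrite doob_martingale0; apply: eq_integrable (integrable0 P setT).
by rewrite doob_martingaleS; apply: integrable_rvD => //; exact: integrable_rvB.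
Qed.

Lemma martingale_doob : martingale P G M.
Proof.
split; [exact: measurable_doob_martingale|exact: integrable_doob_martingale|].
move=> i j ij; apply: condexp_ae => //; split.
- exact: measurable_doob_martingale.
- exact: integrable_doob_martingale.
move=> A GA; rewrite -(subnK ij); elim: (j - i)%N => [//|k IH].
have GA' : G (k + i)%N A by apply: subG GA; rewrite leq_addl.
have mA := mG GA.
rewrite addSn doob_martingaleS integral_rvD //; last 2 first.
  exact: integrable_doob_martingale.
  exact: integrable_rvB.
rewrite integral_rvB //; have [_ _ CE] := CP (k + i)%N.
have -> : \int[P]_(w in A) (C (k + i) w)%:E =
    \int[P]_(w in A) (Y (k + i).+1 w)%:E.
  exact: CE.
by rewrite subee ?adde0 // integral_rv_fin.
Qed.

(* Almost surely the increments [Y j - C j] of the compensator are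
   nonnegative; the absolute values make its limit an honest series. *)
Let T j w : R := `|Y j w - C j w|%R.

Let mT j : measurable_fun setT (T j).
Proof.
apply: measurableT_comp => //; apply: measurable_funB.
  exact: (integrable_rv_measurable (iY j)).
exact: (integrable_rv_measurable (iC j)).
Qed.

Lemma ae_snell_gap_ge0 : {ae P, forall w j, (0 <= Y j w - C j w)%R}.
Proof.
apply: ae_foralln => j; have [_ _ H _] := snellY j.
by apply: filterS H => w ->; rewrite subr_ge0 le_max lexx orbT.
Qed.

Let intT j :
  \int[P]_w (T j w)%:E = \int[P]_w (Y j w)%:E - \int[P]_w (Y j.+1 w)%:E.
Proof.
transitivity (\int[P]_w (Y j w - C j w)%:E).
  apply: ae_eq_integral_rv => //.
    apply: measurable_funB; first exact: (integrable_rv_measurable (iY j)).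
    exact: (integrable_rv_measurable (iC j)).
  by apply: filterS ae_snell_gap_ge0 => w /(_ j) H; rewrite /T ger0_norm.
rewrite integral_rvB //; congr (_ - _); have [_ _ CE] := CP j; exact: CE.
Qed.

Let ae_Y_ge0 : {ae P, forall w j, (0 <= Y j w)%R}.
Proof.
apply: filterS (ae_snell_ge snellY) => w H j; exact: le_trans (H j).
Qed.

Let Tsum w : \bar R := \sum_(0 <= j <oo) (T j w)%:E.

Let Tsum_ge0 w : 0 <= Tsum w.
Proof. by apply: nneseries_ge0 => j _ _; rewrite lee_fin normr_ge0. Qed.

Let mTsum : measurable_fun setT Tsum.
Proof.
apply: ge0_emeasurable_sum => [k w _|k _]; first by rewrite lee_fin normr_ge0.
exact/measurable_EFinP.
Qed.

(** The expectations of the partial sums telescope to the difference of those of [Y 0] and [Y k],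
    and [Y k] is almost surely nonnegative. *)
Let int_Tsum : \int[P]_w Tsum w <= \int[P]_w (Y 0%N w)%:E.
Proof.
rewrite integral_nneseries //; last 2 first.
- by move=> j; exact/measurable_EFinP.
- by move=> j w _; rewrite lee_fin normr_ge0.
have T0 j : 0 <= \int[P]_w (T j w)%:E.
  by apply: integral_ge0 => w _; rewrite lee_fin normr_ge0.
apply: lime_le; first by apply: is_cvg_nneseries => j _ _; exact: T0.
apply: nearW => k.
have fY j : \int[P]_w (Y j w)%:E \is a fin_num by exact: integral_rv_fin.
have -> : \sum_(0 <= j < k) \int[P]_w (T j w)%:E =
    \int[P]_w (Y 0%N w)%:E - \int[P]_w (Y k w)%:E.
  elim: k => [|k IH]; first by rewrite big_geq // subee.
  by rewrite big_nat_recr //= IH intT addeA subeK.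
rewrite leeBlDr // leeDl //; apply: ae_integral_ge0 => //.
by apply: filterS ae_Y_ge0.
Qed.

Let iTsum : P.-integrable setT Tsum.
Proof.
apply/integrableP; split => //.
under eq_integral do rewrite gee0_abs //.
apply: le_lt_trans int_Tsum _.
by rewrite -ge0_fin_numE ?integral_rv_fin //; apply: ae_integral_ge0 => //;
  apply: filterS ae_Y_ge0.
Qed.

Let W w : R := (`|Y 0%N w| + fine (Tsum w) + future_sup U 0 w)%R.

Let iTr : integrable_rv P (fine \o Tsum).
Proof.
have mTr : measurable_fun setT (fine \o Tsum).
  exact: (measurableT_comp (@fine_measurable R setT measurableT)).
apply/integrableP; split; first exact/measurable_EFinP.
have /integrableP[_] := iTsum; apply: le_lt_trans; apply: ge0_le_integral => //.
- by apply: measurableT_comp => //; exact/measurable_EFinP.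
- exact: measurableT_comp.
- by move=> w _ /=; case: (Tsum w) => [r| |] //=; rewrite normr0 leey.
Qed.

(** The summand [Y i] in the bound of [M i] is controlled by [future_sup U 0] only in integral over
    events of [G i], not pointwise; the criterion for uniform integrability is stated for this kind
    of domination. *)
Lemma uniformly_integrable_doob : uniformly_integrable P M.
Proof.
have iW : integrable_rv P W.
  apply: integrable_rvD => //; apply: integrable_rvD => //.
  exact: integrable_rv_norm.
apply: (uniformly_integrable_dominated cG measurable_doob_martingale
  integrable_doob_martingale iW).
  move=> w; rewrite /W addr_ge0 ?(future_sup_ge0 U_ge0) // addr_ge0 //.
  exact: fine_ge0.
move=> i A GA; have mA := mG GA.
have iV : integrable_rv P (fun w => `|Y 0%N w| + fine (Tsum w))%R.
  by apply: integrable_rvD => //; exact: integrable_rv_norm.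
rewrite [leRHS](integral_rvD mA iV (iS 0)).
apply: (@le_trans _ _
  (\int[P]_(w in A) (`|Y 0%N w| + fine (Tsum w) + Y i w)%:E)).
  apply: ae_le_integral => //.
  - exact: integrable_rv_norm (integrable_doob_martingale i).
  - exact: (integrable_rvD iV).
  have := integrable_ae measurableT iTsum.
  apply: filterS2 ae_Y_ge0 => w Y0 /(_ I) fT _.
  rewrite doob_martingaleE.
  have sumT : (`|\sum_(j < i) (Y j w - C j w)| <= fine (Tsum w))%R.
    rewrite (le_trans (ler_norm_sum _ _ _)) // -lee_fin fineK //.
    rewrite -(big_mkord xpredT (T ^~ w)) -sumEFin.
    by apply: nneseries_lim_ge => j _ _; rewrite lee_fin normr_ge0.
  rewrite (le_trans (ler_normD _ _)) // [leRHS]addrAC.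
  apply: lerD => //; rewrite addrC (le_trans (ler_normB _ _)) //.
  by rewrite (ger0_norm (Y0 i)) addrC.
by rewrite (integral_rvD mA iV) //; apply: leeD2l; exact: snell_integral_le0.
Qed.

Lemma doob_UI_martingale0 : UI_martingale0 P G M.
Proof.
split; [exact: martingale_doob|exact: uniformly_integrable_doob|].
by apply: aeW => w; rewrite doob_martingale0.
Qed.

Variable D : nat -> set Omega.
Hypothesis GD : forall i, G i (D i).
Hypothesis D_dead :
  {ae P, forall w i j, (i <= j)%N -> D i w -> U j w = 0%R}.
Hypothesis D_ev : {ae P, forall w, exists k, forall j, (k <= j)%N -> D j w}.

Lemma strong_duality : {ae P, forall w,
  (Y 0%N w)%:E = ereal_sup [set (U i w - M i w)%:E | i in [set: nat]]}.
Proof.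
have DPP : {ae P, forall w j, Y j w = Num.max (U j w) (C j w)}.
  by apply: ae_foralln => j; have [] := snellY j.
have fs := ae_first_stop cG mU U_ge0 int_supU GD D_dead D_ev snellY.
apply: filterS2 DPP fs => w DPP fs.
have gap j : (0 <= Y j w - C j w)%R.
  by rewrite DPP subr_ge0 le_max lexx orbT.
apply/eqP; rewrite eq_le; apply/andP; split; last first.
  apply: ge_ereal_sup => _ [i _ <-]; rewrite lee_fin doob_martingaleE.
  have UY : (U i w <= Y i w)%R by rewrite DPP le_max lexx.
  have := @sumr_ge0 R _ (index_enum 'I_i) xpredT (fun j => Y j w - C j w)%R
    (fun j _ => gap j).
  set s := (\sum_(j < i) _)%R; lra.
apply: ereal_sup_ubound; exists (first_stop U Y 0 w) => //.
rewrite doob_martingaleE big1; first by rewrite fs; congr EFin; lra.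
move=> j _; have : (0 <= j < first_stop U Y 0 w)%N := ltn_ord j.
move=> /first_stop_gt.
by rewrite {1}DPP lt_max ltxx /= => UC; rewrite DPP max_r ?subrr // ltW.
Qed.

End doob_snell.

(** * Duality in discrete time *)

Section discrete_duality.
Context {d : measure_display} {Omega : measurableType d} {R : realType}.
Variables (P : probability Omega R) (G : nat -> set (set Omega)).
Variable U : nat -> Omega -> R.
Hypothesis cG : forall i, complete_sub_sigma P (G i).
Hypothesis subG : forall i j, (i <= j)%N -> G i `<=` G j.
Hypothesis mU : forall i, measurable_wrt (G i) (U i).
Hypothesis U_ge0 : forall i w, (0 <= U i w)%R.
Hypothesis int_supU :
  \int[P]_w ereal_sup [set (U i w)%:E | i in [set: nat]] < +oo.
Variable D : nat -> set Omega.
Hypothesis GD : forall i, G i (D i).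
Hypothesis D_dead :
  {ae P, forall w i j, (i <= j)%N -> D i w -> U j w = 0%R}.
Hypothesis D_ev : {ae P, forall w, exists k, forall j, (k <= j)%N -> D j w}.

(** As a chosen essential supremum, the envelope is by definition measurable only for the full
    sigma-algebra. Its almost sure equality with [snell_value] and completeness of [G i] give
    measurability at index [i], and the remaining clauses transfer as well. *)
Lemma snell_envelope_process : snell_process P G U (snell_envelope P G U).
Proof.
have sv := snell_value_process cG subG mU U_ge0 int_supU.
have YV := ae_snell_envelope cG subG mU U_ge0 int_supU GD D_dead D_ev sv.
have mY i : measurable_wrt (G i) (snell_envelope P G U i).
  have [mV _ _ _] := sv i; apply: measurable_wrt_ae mV => //.
  by apply: filterS (YV i) => w.
move=> i; have [mV iV DPP Vle] := sv i; have [sG mG _] := cG i.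
have mYi j : measurable_fun setT (snell_envelope P G U j).
  by have [sGj mGj _] := cG j; exact: (measurable_wrt_fun sGj mGj (@mY j)).
split => //.
- by apply: ae_integrable_rv iV => //; apply: filterS (YV i) => w.
- rewrite (@condexp_congr _ _ _ P (G i) _ (snell_value P G U i.+1)) //.
    by apply: filterS2 (YV i) DPP => w ->.
  by have [_ /integrable_rv_measurable] := sv i.+1.
- by apply: filterS2 (YV i) Vle => w ->.
Qed.

Let sG i : sigma_algebra setT (G i). Proof. by have [] := cG i. Qed.
Let Y := snell_envelope P G U.
Let M := doob_martingale P G Y.

Theorem discrete_duality :
  ereal_sup [set 'E_P[at_rule U n] | n in stopping_rule G] =
  ereal_inf [set \int[P]_w ereal_sup [set (U i w - M i w)%:E | i in [set: nat]]
              | M in UI_martingale0 P G]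
  /\
  (UI_martingale0 P G M /\
   {ae P, forall w,
      (Y 0%N w)%:E = ereal_sup [set (U i w - M i w)%:E | i in [set: nat]]}).
Proof.
have sY := snell_envelope_process.
have MUI : UI_martingale0 P G M.
  exact: (doob_UI_martingale0 cG subG mU U_ge0 int_supU sY).
have strong := strong_duality cG mU U_ge0 int_supU sY GD D_dead D_ev.
split; last by split.
have [mM iM _] : martingale P G M by have [] := MUI.
have iU := integrable_U cG mU U_ge0 int_supU.
apply/eqP; rewrite eq_le; apply/andP; split.
  apply: ge_ereal_sup => _ [n nG <-]; apply: le_ereal_inf_tmp => _ [M' M'UI <-].
  rewrite expectation.unlock.
  exact: (weak_duality cG subG iU U_ge0 M'UI nG).
(* For the reverse inequality, the expectation of [Y 0] is the link: it is at most the reward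
   expected at this rule, and it is the dual value of the Doob martingale. *)
pose n := first_stop U Y 0.
have nG : stopping_rule G n.
  exact: (first_stop_rule cG subG mU U_ge0 int_supU GD D_dead D_ev sY).
apply: (@le_trans _ _ 'E_P[at_rule U n]); last first.
  by apply: ereal_sup_ubound; exists n.
apply: (@le_trans _ _ (\int[P]_w (Y 0%N w)%:E)); last first.
  rewrite expectation.unlock.
  apply: (snell_le_first_stop cG subG mU U_ge0 int_supU GD D_dead D_ev sY).
  by have [h0 hC _] := sG 0; rewrite -(setD0 setT); exact: hC.
rewrite (_ : \int[P]_w (Y 0%N w)%:E = \int[P]_w ereal_sup
   [set (U i w - M i w)%:E | i in [set: nat]]); last first.
  have [_ iY _ _] := sY 0%N.
  apply: ae_eq_integral => //.
  - exact: (measurable_int P iY).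
  - apply: (@measurable_ereal_sup _ _ _ (fun i => U i \- M i)%R) => i.
    apply: measurable_funB; first exact: (integrable_rv_measurable (iU i)).
    exact: (integrable_rv_measurable (iM i)).
  - by apply: filterS strong => w ->.
by apply: ereal_inf_lbound; exists M.
Qed.

End discrete_duality.

(** * Sampling at stopping times *)

Section stopping_times.
Context {d : measure_display} {Omega : measurableType d} {R : realType}.
Variables (P : probability Omega R) (F : \bar R -> set (set Omega)).
Hypotheses (HF : is_filtration F) (HFusual : usual_conditions P F).
Implicit Types (t : \bar R) (sigma : Omega -> \bar R).

Lemma filtration_complete t : 0 <= t -> complete_sub_sigma P (F t).
Proof.
move=> t0; have [sF mF FS] := HF; have [_ nF] := HFusual.
split; [exact: sF|exact: mF|] => A nA.
by apply: (FS 0 t) => //; exact: nF.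
Qed.

Let sF t : 0 <= t -> sigma_algebra setT (F t).
Proof. by have [sF _ _] := HF; exact: sF. Qed.
Let FS s t : 0 <= s -> s <= t -> F s `<=` F t.
Proof. by have [_ _ FS] := HF; exact: FS. Qed.

Lemma stopped_sigma_complete sigma : stopping_time F sigma ->
  complete_sub_sigma P (stopped_sigma_algebra F sigma).
Proof.
move=> [sg0 sgF].
have null A t : 0 <= t -> P.-negligible A -> F t A.
  by move=> t0 nA; have [_ _] := filtration_complete t0; exact.
split.
- split=> [t t0|A GA t t0|A GA t t0].
  + by rewrite set0I; have [] := sF t0.
  + rewrite setTD (_ : ~` A `&` _ = [set w | sigma w <= t] `&`
        ~` (A `&` [set w | sigma w <= t])); last first.
      apply/seteqP; split=> w /=; first by move=> [nA st]; split=> // -[].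
      by move=> [st nA]; split=> // Aw; apply: nA.
    apply: (sigma_setI (sF t0)); first exact: sgF.
    by apply: (sigma_setC (sF t0)); exact: GA.
  + rewrite setI_bigcupl; have [_ _ cup] := sF t0.
    by apply: cup => i; exact: GA.
- move=> A /(_ +oo (leey _)); rewrite (_ : A `&` _ = A).
    by have [_ mF _] := HF; exact: mF.
  by apply/seteqP; split=> w /=; [case|move=> Aw; split=> //; exact: leey].
- move=> A nA t t0; apply: null => //.
  by apply: negligibleS nA => w [].
Qed.

(** The times are ordered only almost surely, so the event to be placed in [F t] is first replaced
    by its intersection with [sigma w <= t], from which it differs by a null set. *)
Lemma stopped_sigma_le sigma sigma' : stopping_time F sigma ->
  stopping_time F sigma' -> {ae P, forall w, sigma w <= sigma' w} ->
  stopped_sigma_algebra F sigma `<=` stopped_sigma_algebra F sigma'.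
Proof.
move=> [sg0 sgF] [sg0' sgF'] le A GA t t0.
apply: (complete_sub_sigma_ae_eqset (filtration_complete t0)
   (A := (A `&` [set w | sigma w <= t]) `&` [set w | sigma' w <= t])).
  apply: filterS le => w le; split=> /= [[[]]//|[Aw s't]].
  by split=> //; split=> //; exact: le_trans s't.
by apply: (sigma_setI (sF t0)); [exact: GA|exact: sgF'].
Qed.

Let ge0_real (x : \bar R) (a : R) : 0 <= x -> x <= a%:E ->
  exists2 r : R, x = r%:E & (0 <= r <= a)%R.
Proof.
move=> x0 xa; have fx : x \is a fin_num.
  by rewrite ge0_fin_numE // (le_lt_trans xa) // ltry.
exists (fine x); first by rewrite fineK.
by rewrite -!lee_fin fineK // x0.
Qed.

Lemma stopping_time_lt sigma (a : R) : stopping_time F sigma -> (0 <= a)%R ->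
  F a%:E [set w | sigma w < a%:E].
Proof.
move=> [sg0 sgF]; rewrite le_eqVlt => /orP[/eqP <-|a0].
  rewrite (_ : [set w | _] = set0); first by have [] := sF (lexx 0).
  by apply/seteqP; split=> w //=; rewrite ltNge sg0.
have a0E : 0 <= a%:E by rewrite lee_fin ltW.
(* The approximating times are [a - a / k.+1] and not [a - 1 / k.+1], so that they remain
   nonnegative. *)
have -> : [set w | sigma w < a%:E] =
    \bigcup_k [set w | sigma w <= (a - a / k.+1%:R)%:E].
  apply/seteqP; split=> w /=.
    move=> sa; have [r sr /andP[r0 _]] := ge0_real (sg0 w) (ltW sa).
    move: sa; rewrite sr lte_fin => ra.
    have ar : (0 < a - r)%R by rewrite subr_gt0.
    exists (Num.bound (a / (a - r))) => //=; rewrite sr lee_fin.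
    rewrite lerBrDr -lerBrDl ler_pdivrMr // mulrC -ler_pdivrMr //.
    have a1 : (0 <= a / (a - r))%R by rewrite divr_ge0 // ltW.
    by rewrite (le_trans (ltW (archi_boundP a1))) // ler_nat.
  by move=> [k _ /=] /le_lt_trans; apply; rewrite lte_fin gtrBl divr_gt0.
have [_ _ cup] := sF a0E; apply: cup => k.
have k0 : (0 <= a - a / k.+1%:R)%R.
  by rewrite subr_ge0 ler_pdivrMr // ler_peMr ?ler1n // ltW.
apply: (FS (s := (a - a / k.+1%:R)%:E)).
- by rewrite lee_fin.
- by rewrite lee_fin lerBlDr lerDl divr_ge0 // ltW.
- by apply: sgF; rewrite lee_fin.
Qed.

(** * Measurability of the sampled process *)

Variables (T : R) (Z : R -> Omega -> R).
Hypothesis T0 : (0 < T)%R.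
Hypothesis HZadapted : adapted F Z.
Hypothesis HZcadlag : {ae P, forall w, cadlag_on T (fun u => Z u w)}.
Hypothesis HZT : {ae P, forall w, forall u : R, (T < u)%R -> Z u w = 0%R}.
Variable sigma : Omega -> \bar R.
Hypothesis Hsigma : stopping_time F sigma.

Let sigma_ge0 w : 0 <= sigma w. Proof. by have [] := Hsigma. Qed.
Let T0E : 0 <= T%:E. Proof. by rewrite lee_fin ltW. Qed.

Lemma stopped_sigma_gt : stopped_sigma_algebra F sigma [set w | T%:E < sigma w].
Proof.
have [_ sgF] := Hsigma; move=> t t0.
have [Tt|tT] := leP T%:E t.
  apply: (sigma_setI (sF t0)); last exact: sgF.
  rewrite (_ : [set w | _] = ~` [set w | sigma w <= T%:E]).
    by apply: (sigma_setC (sF t0)); apply: (FS T0E Tt); exact: sgF.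
  by apply/seteqP; split=> w /=; rewrite ltNge => /negP.
rewrite (_ : _ `&` _ = set0); first by have [] := sF t0.
apply/seteqP; split=> w //= [Ts st].
by have := lt_le_trans Ts (le_trans st (ltW tT)); rewrite ltxx.
Qed.

(* Strictly to the right of [r], as the right limit ignores [Z r]. *)
Let grid (e : R) (n : nat) (r : R) : R :=
  ((Num.truncn (r / (e / n.+1%:R))).+1%:R * (e / n.+1%:R))%R.

Let grid_itv e n r : (0 < e)%R -> (0 <= r)%R ->
  (r < grid e n r <= r + e / n.+1%:R)%R.
Proof.
move=> e0 r0; rewrite /grid; set m := (e / n.+1%:R)%R.
have m0 : (0 < m)%R by rewrite divr_gt0.
have /truncn_itv/andP[h1 h2] : (0 <= r / m)%R by rewrite divr_ge0 // ltW.
rewrite -ltr_pdivrMr // h2 /= -addn1 natrD mulrDl mul1r lerD2r.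
by rewrite -ler_pdivlMr.
Qed.

Let grid_cvg e r : (0 < e)%R -> (0 <= r)%R -> grid e n r @[n --> \oo] --> r.
Proof.
move=> e0 r0; apply: (@squeeze_cvgr _ _ _ _ (cst r)
  (fun n => r + e / n.+1%:R)%R).
- by apply: nearW => n; have /andP[/ltW -> ->] := grid_itv n e0 r0.
- exact: cvg_cst.
- rewrite -[X in _ --> X]addr0; apply: cvgD; first exact: cvg_cst.
  rewrite -(mulr0 e); apply: cvgM; first exact: cvg_cst.
  exact: cvg_harmonic.
Qed.

(* By right continuity of the filtration it suffices to work in [F s] for
   [s > t], which leaves room for approximating [sigma] from the right. *)
Let before (t : R) (B : set R) : (0 <= t)%R -> measurable B ->
  F t%:E ((sample_at Z sigma @^-1` B) `&`
     [set w | sigma w <= t%:E /\ sigma w < T%:E]).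
Proof.
move=> t0 mB; have [right_cont _] := HFusual.
have t0E : 0 <= t%:E by rewrite lee_fin.
rewrite right_cont ?ltry //= => s' ts'.
have [s [ts ss']] : exists s : R, (t < s)%R /\ s%:E <= s'.
  case: s' ts' => [s| |] //; first by rewrite lte_fin => ts; exists s.
  by move=> _; exists (t + 1)%R; rewrite ltrDl ltr01 leey.
have s0 : 0 <= s%:E by rewrite lee_fin (le_trans t0) // ltW.
apply: (FS s0 ss'); have sFs := sF s0.
have cFs := filtration_complete s0.
pose A := [set w | sigma w <= t%:E /\ sigma w < T%:E].
have FA : F s%:E A.
  have [_ sgF] := Hsigma.
  have [Tt|tT] := leP T t.
    rewrite (_ : A = [set w | sigma w < T%:E]).
      apply: (FS T0E); first by rewrite lee_fin (le_trans Tt) // ltW.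
      by apply: stopping_time_lt => //; exact: ltW.
    apply/seteqP; split=> w; rewrite /A /=; first by case.
    by move=> sT; split=> //; rewrite (le_trans (ltW sT)) // lee_fin.
  rewrite (_ : A = [set w | sigma w <= t%:E]).
    by apply: (FS t0E); [rewrite lee_fin ltW|exact: sgF].
  apply/seteqP; split=> w; rewrite /A /=; first by case.
  by move=> st; split=> //; rewrite (le_lt_trans st) // lte_fin.
pose N := ~` [set w | cadlag_on T (fun u => Z u w)].
have FN : F s%:E N by have [_ _] := cFs; apply; exact: HZcadlag.
pose A' := A `&` ~` N.
have FA' : F s%:E A' by apply: (sigma_setI sFs) => //; exact: (sigma_setC sFs).
suff : F s%:E (A' `&` sample_at Z sigma @^-1` B).
  apply: (complete_sub_sigma_ae_eqset cFs); apply: filterS HZcadlag => w cw.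
  rewrite /A' /N; split=> [[[Aw _] Bw]|[Bw Aw]]; split=> //.
  by split=> // /(_ cw).
(* With mesh at most [s - t], the grid point following a time up to [t] does not pass [s], so only
   values of [Z] measurable for [F s] occur. *)
pose e := (s - t)%R; have e0 : (0 < e)%R by rewrite subr_gt0.
pose h n w := Z (grid e n (fine (sigma w))) w.
pose Fs := g_sigma_algebraType (F s%:E).
have mA' : @measurable _ Fs A' by rewrite measurable_g_measurableTypeE.
have sigmaE w : A' w -> exists2 r : R, sigma w = r%:E & (0 <= r <= t)%R.
  by move=> [[st _] _]; exact: ge0_real.
have : @measurable_fun _ _ Fs _ A' (sample_at Z sigma).
  apply: (@measurable_fun_cvg _ Fs _ A' h); last first.
    move=> w A'w; have [r sr /andP[r0 rt]] := sigmaE w A'w.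
    have [[_ sT] /contrapT [cw _]] := A'w.
    rewrite /h /sample_at sr /=.
    have /cw/cvg_at_rightP : (0 <= r < T)%R by rewrite r0 -lte_fin -sr.
    apply; split; last exact: grid_cvg.
    by move=> n; have /andP[] := grid_itv n e0 r0.
  move=> n _ B' mB'; rewrite measurable_g_measurableTypeE //.
  pose m := (e / n.+1%:R)%R.
  have m0 : (0 < m)%R by rewrite divr_gt0.
  have me : (m <= e)%R by rewrite ler_pdivrMr // ler_peMr ?ler1n // ltW.
  (* On [A'] the grid point is [k.+1 * m] exactly when [sigma] lies in the cell from [k * m]
     included to [k.+1 * m] excluded; cells ending after [s] do not meet [A']. *)
  pose Q k := if (k.+1%:R * m <= s)%R then
    A' `&` ([set w | sigma w < (k.+1%:R * m)%:E] `&`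
            ~` [set w | sigma w < (k%:R * m)%:E]) `&`
    (Z (k.+1%:R * m)%R @^-1` B')
    else set0.
  rewrite (_ : A' `&` _ = \bigcup_k Q k).
    have [_ _ cup] := sFs; apply: cup => k; rewrite /Q.
    case: ifP => [ks|_]; last by have [] := sFs.
    have km0 : (0 <= k.+1%:R * m)%R by rewrite mulr_ge0 // ltW.
    apply: (sigma_setI sFs); last first.
      apply: (FS (s := (k.+1%:R * m)%:E)); rewrite ?lee_fin //.
      have sFk : sigma_algebra setT (F (k.+1%:R * m)%:E).
        by apply: sF; rewrite lee_fin.
      exact: ((measurable_wrtP _ sFk).1 (HZadapted km0)).
    apply: (sigma_setI sFs) => //; apply: (sigma_setI sFs).
      apply: (FS (s := (k.+1%:R * m)%:E)); rewrite ?lee_fin //.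
      exact: stopping_time_lt.
    apply: (sigma_setC sFs).
    have km0' : (0 <= k%:R * m)%R by rewrite mulr_ge0 // ltW.
    apply: (FS (s := (k%:R * m)%:E)); rewrite ?lee_fin //.
      by rewrite (le_trans _ ks) // ler_pM2r // ler_nat.
    exact: stopping_time_lt.
  apply/seteqP; split=> w /=.
    move=> [A'w]; have [r sr /andP[r0 rt]] := sigmaE w A'w.
    rewrite /h sr /= /grid -/m => hB; exists (Num.truncn (r / m)) => //.
    have rm0 : (0 <= r / m)%R by rewrite divr_ge0 // ltW.
    have /andP[h1 h2] := truncn_itv rm0.
    rewrite /Q ifT; last first.
      rewrite -addn1 natrD mulrDl mul1r (@le_trans _ _ (r + m)%R) //.
        by rewrite lerD2r -ler_pdivlMr.
      by rewrite -lerBrDl (le_trans me) // lerD2l lerN2.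
    split=> //; split=> //; split; rewrite /= sr lte_fin -ltr_pdivrMr //.
    by rewrite ltNge h1.
  move=> [k _]; rewrite /Q; case: ifP => // ks [[A'w [sk /negP]]].
  have [r sr /andP[r0 rt]] := sigmaE w A'w.
  move: sk; rewrite /= sr !lte_fin -leNgt => rk kr hB; split=> //.
  rewrite /h sr /= /grid -/m (@truncn_def _ _ k) //.
  by rewrite ler_pdivlMr // ltr_pdivrMr // kr rk.
move=> /(_ mA' B mB); rewrite measurable_g_measurableTypeE //.
Qed.

(** Approximation from the right could fail at [T]. Here the sample is [Z T] itself, and the event
    [sigma w = T] lies in the sigma-algebra at time [T]. *)
Let at_horizon (t : R) (B : set R) : (0 <= t)%R -> measurable B ->
  F t%:E ((sample_at Z sigma @^-1` B) `&`
     [set w | sigma w <= t%:E /\ sigma w = T%:E]).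
Proof.
move=> t0 mB; have t0E : 0 <= t%:E by rewrite lee_fin.
have [_ sgF] := Hsigma.
have [Tt|tT] := leP T t; last first.
  rewrite (_ : _ `&` _ = set0); first by have [] := sF t0E.
  apply/seteqP; split=> w //= [_ [st sT]]; move: st.
  by rewrite sT lee_fin leNgt tT.
apply: (FS T0E); first by rewrite lee_fin.
rewrite (_ : _ `&` _ = (Z T @^-1` B) `&`
    ([set w | sigma w <= T%:E] `&` ~` [set w | sigma w < T%:E])).
  apply: (sigma_setI (sF T0E)).
    exact: ((measurable_wrtP _ (sF T0E)).1 (HZadapted (ltW T0))).
  apply: (sigma_setI (sF T0E)); first exact: sgF.
  apply: (sigma_setC (sF T0E)).
  by apply: stopping_time_lt => //; exact: ltW.
apply/seteqP; split=> w; rewrite /sample_at /=.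
  by move=> [+ [_ sT]]; rewrite sT lexx ltxx.
move=> [ZB [sT /negP]]; rewrite -leNgt => Ts.
have -> : sigma w = T%:E by apply/eqP; rewrite eq_le sT Ts.
by rewrite lee_fin.
Qed.

(** Past [T] the sample is almost surely 0, so up to a null set the event is all of [T < sigma <= t]
    or empty, according to whether [B] contains 0. *)
Let after (t : R) (B : set R) : (0 <= t)%R ->
  F t%:E ((sample_at Z sigma @^-1` B) `&`
     [set w | sigma w <= t%:E /\ T%:E < sigma w]).
Proof.
move=> t0; have t0E : 0 <= t%:E by rewrite lee_fin.
have FD := stopped_sigma_gt t0E.
have [B0|B0] := pselect (B 0%R).
  apply: (complete_sub_sigma_ae_eqset (filtration_complete t0E) _ FD).
  apply: filterS HZT => w ZT; split=> [[Ts st]|[_ [st Ts]]] //; split=> //.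
  have [r sr _] := ge0_real (sigma_ge0 w) st.
  by rewrite /= /sample_at sr ZT // -lte_fin -sr.
have F0 : F t%:E set0 by have [] := sF t0E.
apply: (complete_sub_sigma_ae_eqset (filtration_complete t0E) _ F0).
apply: filterS HZT => w ZT; split=> // -[+ [st Ts]].
have [r sr _] := ge0_real (sigma_ge0 w) st.
by rewrite /= /sample_at sr ZT // -lte_fin -sr.
Qed.

Lemma measurable_sample_at : {ae P, forall w, sigma w < +oo} ->
  measurable_wrt (stopped_sigma_algebra F sigma) (sample_at Z sigma).
Proof.
move=> sfin; have [sG mG nG] := stopped_sigma_complete Hsigma.
apply/(measurable_wrtP _ sG) => B mB.
have real (t : R) : (0 <= t)%R ->
    F t%:E ((sample_at Z sigma @^-1` B) `&` [set w | sigma w <= t%:E]).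
  move=> t0; have t0E : 0 <= t%:E by rewrite lee_fin.
  have := sigma_setU (sF t0E) (sigma_setU (sF t0E) (before t0 mB)
    (at_horizon t0 mB)) (after B t0).
  rewrite -!setIUr; congr (F _ (_ `&` _)).
  apply/seteqP; split=> w /=; last first.
    move=> st; split=> //.
    by case: (ltgtP (sigma w) T%:E); [left; left|right|left; right].
  by case.
move=> t t0; case: t t0 => [t| |] //; first by rewrite lee_fin; exact: real.
move=> t0; have [_ _ cup] := sF t0.
(* For the infinite time, the preimage is exhausted along integer times up to the null event where
   [sigma] is infinite. *)
have : F +oo (\bigcup_n ((sample_at Z sigma @^-1` B) `&`
                         [set w | sigma w <= n%:R%:E])).
  apply: cup => n; apply: (FS (s := n%:R%:E)) => //; rewrite ?lee_fin ?leey //.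
  exact: real.
apply: (complete_sub_sigma_ae_eqset (filtration_complete t0)).
apply: filterS sfin => w sw; split=> [[n _ [Bw _]]|[Bw _]].
  by split=> //=; exact: leey.
have fs : sigma w \is a fin_num by rewrite ge0_fin_numE.
exists (Num.bound (fine (sigma w))) => //; split=> //=.
rewrite -(fineK fs) lee_fin ltW // archi_boundP //.
exact: fine_ge0.
Qed.

End stopping_times.

(** * Duality for the reward sampled at stopping times *)

Theorem proposition5 (d : measure_display) (Omega : measurableType d)
    (R : realType) (P : probability Omega R)
    (F : \bar R -> set (set Omega))
    (tau : nat -> Omega -> \bar R) (T : R) (Z : R -> Omega -> R)
    (alpha B : R)
    (HF : is_filtration F) (HFusual : usual_conditions P F)
    (Htau : forall i, stopping_time F (tau i))
    (Htau0 : {ae P, forall w, tau 0%N w = 0})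
    (Htau_lt : {ae P, forall w, forall i, tau i w < tau i.+1 w < +oo})
    (Htau_lim : {ae P, forall w, tau i w @[i --> \oo] --> +oo})
    (HT : (0 < T)%R)
    (HZ0 : forall (t : R) w, (0 <= t)%R -> (0 <= Z t w)%R)
    (HZadapted : adapted F Z)
    (HZcadlag : {ae P, forall w, cadlag_on T (fun t => Z t w)})
    (HZT : {ae P, forall w, forall t : R, (T < t)%R -> Z t w = 0%R})
    (Halpha : (1 < alpha)%R) (HB : (0 < B)%R) :
  let U := fun i => sample_at Z (tau i) in
  let G := fun i => stopped_sigma_algebra F (tau i) in
  let Y := snell_envelope P G U in
  let Mo := doob_martingale P G Y in
  \int[P]_w ereal_sup [set ((U i w) `^ alpha)%:E | i in [set: nat]]
    <= (B `^ alpha)%:E ->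
  \int[P]_w (first_index_after tau T w *
             ereal_sup [set (U i w)%:E | i in [set: nat]]) < +oo ->
  ereal_sup [set 'E_P[at_rule U n] | n in stopping_rule G] =
  ereal_inf [set \int[P]_w ereal_sup [set (U i w - M i w)%:E | i in [set: nat]]
              | M in UI_martingale0 P G]
  /\
  (UI_martingale0 P G Mo /\
   {ae P, forall w,
      (Y 0%N w)%:E = ereal_sup [set (U i w - Mo i w)%:E | i in [set: nat]]}).
Proof.
move=> U G Y Mo _ NU.
have lt_tau i : {ae P, forall w, tau i w < +oo}.
  apply: filterS Htau_lt => w H.
  by have /andP[ti _] := H i; rewrite (lt_le_trans ti) ?leey.
have tau_le : {ae P, forall w i j, (i <= j)%N -> tau i w <= tau j w}.
  apply: filterS Htau_lt => w H i j ij.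
  by apply: (@nondecreasing_seqP _ _ (tau ^~ w)).1 ij => k;
    have /andP[/ltW] := H k.
have cG i : complete_sub_sigma P (G i).
  exact: stopped_sigma_complete (Htau i).
have subG i j : (i <= j)%N -> G i `<=` G j.
  move=> ij; apply: (stopped_sigma_le HF HFusual) => //.
  by apply: filterS tau_le => w; exact.
have U0 i w : (0 <= U i w)%R.
  rewrite /U /sample_at; have [+ _] := Htau i => /(_ w).
  by case: (tau i w) => [r| |] //; rewrite lee_fin => r0; exact: HZ0.
have mU i : measurable_wrt (G i) (U i).
  exact: (measurable_sample_at HF HFusual HT HZadapted HZcadlag HZT (Htau i)).
pose S w := ereal_sup [set (U i w)%:E | i in [set: nat]].
have S0 w : 0 <= S w.
  apply: (@le_trans _ _ (U 0%N w)%:E); first by rewrite lee_fin.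
  by apply: ereal_sup_ubound; exists 0%N.
have N1 w : 1 <= first_index_after tau T w.
  by apply: le_ereal_inf_tmp => _ [m [m0 _] <-]; rewrite lee_fin ler1n.
have SN w : S w <= first_index_after tau T w * S w.
  by rewrite -[leLHS]mul1e lee_wpmul2r.
have intS : \int[P]_w S w < +oo.
  (* Both integrals are read as suprema over the simple functions below the integrand, which
     compares them without establishing measurability of the product. *)
  apply: le_lt_trans NU; rewrite !ge0_integralTE //.
    apply: ereal_sup_le => _ [h hS <-]; exists h => // w.
    exact: le_trans (hS w) (SN w).
  by move=> w; exact: le_trans (S0 w) (SN w).
pose D i := [set w | T%:E < tau i w].
have GD i : G i (D i) by exact: (stopped_sigma_gt HF HT (Htau i)).
have D_dead : {ae P, forall w i j, (i <= j)%N -> D i w -> U j w = 0%R}.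
  apply: filterS2 tau_le HZT => w le ZT i j ij Dw.
  have := lt_le_trans Dw (le i j ij); rewrite /U /sample_at.
  by case: (tau j w) => [r| |] //; rewrite lte_fin; exact: ZT.
have D_ev : {ae P, forall w, exists k, forall j, (k <= j)%N -> D j w}.
  apply: filterS Htau_lim => w /cvgeyPgtr/(_ T (num_real T))[k _ H].
  by exists k.
exact: (discrete_duality cG subG mU U0 intS GD D_dead D_ev).
Qed.
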